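(* Let $q=p^e$ be a power of a prime $p>3$ and let $E$ be a supersingular elliptic curve defined over $\mathbb{F}_q$. If $\psi:E\to E'$ is any isogeny of $E$ (over $\overline{\mathbb{F}_q}$), then its kernel is defined over the extension $\mathbb{F}_{q^m}$ with $m=1$, $2$, or $3$. If $j(E)\notin\{0,1728\}$, then we can take $m=1$ if $e$ is even and $m=2$ if $e$ is odd.
   Context: The kernel of $\psi$, viewed as a finite subgroup of $E(\overline{\mathbb{F}_q})$, is defined over $\mathbb{F}_{q^m}$ if it is stable under $\operatorname{Gal}(\overline{\mathbb{F}_q}/\mathbb{F}_{q^m})$, i.e. $\pi^m(\ker\psi)=\ker\psi$ where $\pi$ is the $q$-power Frobenius endomorphism of $E$. *)

(* Defs.v *)
From HB Require Import structures.
From mathcomp Require Import all_boot all_order all_algebra all_fingroup all_field.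
From mathcomp Require Import ring mpoly.

Set Implicit Arguments.
Unset Strict Implicit.
Unset Printing Implicit Defensive.

Import GRing.Theory.
Local Open Scope ring_scope.

(* y^2 + a1 x y + a3 y = x^3 + a2 x^2 + a4 x + a6 *)
Record weierstrass (R : Type) := Weierstrass {
  wa1 : R; wa2 : R; wa3 : R; wa4 : R; wa6 : R
}.

Definition map_weierstrass (R S : Type) (f : R -> S) (W : weierstrass R) :=
  Weierstrass (f (wa1 W)) (f (wa2 W)) (f (wa3 W)) (f (wa4 W)) (f (wa6 W)).

Section Invariants.
Variables (R : comNzRingType) (W : weierstrass R).

Definition wb2 : R := wa1 W ^+ 2 + 4 * wa2 W.
Definition wb4 : R := 2 * wa4 W + wa1 W * wa3 W.
Definition wb6 : R := wa3 W ^+ 2 + 4 * wa6 W.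
Definition wb8 : R :=
  wa1 W ^+ 2 * wa6 W + 4 * wa2 W * wa6 W - wa1 W * wa3 W * wa4 W
  + wa2 W * wa3 W ^+ 2 - wa4 W ^+ 2.
Definition wc4 : R := wb2 ^+ 2 - 24 * wb4.
Definition wdisc : R :=
  - wb2 ^+ 2 * wb8 - 8 * wb4 ^+ 3 - 27 * wb6 ^+ 2 + 9 * wb2 * wb4 * wb6.
End Invariants.

Record ellcurve (F : fieldType) := EllCurve {
  ell_weierstrass :> weierstrass F;
  ell_disc_neq0 : wdisc ell_weierstrass != 0
}.

Definition jinv (F : fieldType) (E : ellcurve F) : F := wc4 E ^+ 3 / wdisc E.

Section BaseChange.
Variables (F K : fieldType) (iota : {rmorphism F -> K}).

Lemma wdisc_map (W : weierstrass F) :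
  wdisc (map_weierstrass iota W) = iota (wdisc W).
Proof.
by rewrite /wdisc /wb8 /wb6 /wb4 /wb2 /=; ring.
Qed.

Lemma base_change_subproof (E : ellcurve F) :
  wdisc (map_weierstrass iota E) != 0.
Proof. by rewrite wdisc_map fmorph_eq0 ell_disc_neq0. Qed.

Definition base_change (E : ellcurve F) : ellcurve K :=
  EllCurve (base_change_subproof E).
End BaseChange.

(* [None] is the point at infinity. *)
Definition oncurve (F : fieldType) (W : weierstrass F) (P : option (F * F)) :=
  if P is Some (x, y) then
    y ^+ 2 + wa1 W * x * y + wa3 W * y
      == x ^+ 3 + wa2 W * x ^+ 2 + wa4 W * x + wa6 W
  else true.

Record point (F : fieldType) (E : ellcurve F) := Point {
  point_val : option (F * F);
  point_oncurve : oncurve E point_val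
}.

HB.instance Definition _ (F : fieldType) (E : ellcurve F) :=
  [isSub for @point_val F E].
HB.instance Definition _ (F : fieldType) (E : ellcurve F) :=
  [Choice of point E by <:].

Section GroupLaw.
Variables (F : fieldType) (E : ellcurve F).

Definition point0 : point E := @Point F E None isT.

(* The third intersection point of the line y = l x + n with the curve, then
   negated, where x1 and x2 are the abscissae of the first two. *)
Definition chord (l n x1 x2 : F) : option (F * F) :=
  let x3 := l ^+ 2 + wa1 E * l - wa2 E - x1 - x2 in
  Some (x3, - (l + wa1 E) * x3 - n - wa3 E).

Definition add_raw (P Q : option (F * F)) : option (F * F) :=
  match P, Q with
  | None, _ => Q
  | _, None => P
  | Some (x1, y1), Some (x2, y2) =>
    if x1 != x2 then
      let l := (y2 - y1) / (x2 - x1) in chord l (y1 - l * x1) x1 x2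
    else if y1 + y2 + wa1 E * x2 + wa3 E == 0 then None
    else
      let l := (3 * x1 ^+ 2 + 2 * wa2 E * x1 + wa4 E - wa1 E * y1)
               / (2 * y1 + wa1 E * x1 + wa3 E) in
      chord l (y1 - l * x1) x1 x2
  end.

Lemma add_raw_oncurve (P Q : option (F * F)) :
  oncurve E P -> oncurve E Q -> oncurve E (add_raw P Q).
Proof.
case: P Q => [[x1 y1]|] [[x2 y2]|] //= /eqP e1 /eqP e2.
set a1 := wa1 E in e1 e2 *; set a2 := wa2 E in e1 e2 *.
set a3 := wa3 E in e1 e2 *; set a4 := wa4 E in e1 e2 *.
set a6 := wa6 E in e1 e2 *.
pose C l n x : F := (l * x + n) ^+ 2 + a1 * x * (l * x + n) + a3 * (l * x + n)
  - (x ^+ 3 + a2 * x ^+ 2 + a4 * x + a6).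
have chordP l n u v : C l n (l ^+ 2 + a1 * l - a2 - u - v) = 0 ->
    oncurve E (chord l n u v).
  rewrite /= -/a1 -/a2 -/a3 -/a4 -/a6.
  set x3 := (_ - v) => h; rewrite -subr_eq0 -h /C; apply/eqP; ring.
have [ne|] := boolP (x1 != x2).
- apply: chordP; set l := _ / _; set n := y1 - _; set x3 := (_ - x2).
  have d0 : x2 - x1 != 0 by rewrite subr_eq0 eq_sym.
  have l1 : l * x1 + n = y1 by rewrite /n; ring.
  have l2 : l * x2 + n = y2.
    by rewrite /n addrCA -mulrBr /l divfK // addrC subrK.
  have c1 : C l n x1 = 0 by rewrite /C l1 e1 subrr.
  have c2 : C l n x2 = 0 by rewrite /C l2 e2 subrr.
  have h : (x2 - x1) * C l n x3 = (x3 - x1) * C l n x2 - (x3 - x2) * C l n x1.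
    rewrite /C /x3; ring.
  move: h; rewrite c1 c2 !mulr0 subrr => /eqP.
  by rewrite mulf_eq0 (negbTE d0) => /eqP.
- rewrite negbK => /eqP ex; subst x2.
  case: ifPn => // ne; apply: chordP.
  have ey : y2 = y1.
    apply/eqP; rewrite -subr_eq0.
    have /eqP : (y2 - y1) * (y1 + y2 + a1 * x1 + a3) = 0.
      have -> : (y2 - y1) * (y1 + y2 + a1 * x1 + a3)
        = (y2 ^+ 2 + a1 * x1 * y2 + a3 * y2)
          - (y1 ^+ 2 + a1 * x1 * y1 + a3 * y1) by ring.
      by rewrite e1 e2 subrr.
    by rewrite mulf_eq0 (negbTE ne) orbF.
  subst y2; set l := _ / _; set n := y1 - _; set x3 := (_ - x1).
  have d0 : 2 * y1 + a1 * x1 + a3 != 0.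
    by have -> : 2 * y1 + a1 * x1 + a3 = y1 + y1 + a1 * x1 + a3 by ring.
  have hl : l * (2 * y1 + a1 * x1 + a3)
      = 3 * x1 ^+ 2 + 2 * a2 * x1 + a4 - a1 * y1 by rewrite /l divfK.
  have l1 : l * x1 + n = y1 by rewrite /n; ring.
  have c1 : C l n x1 = 0 by rewrite /C l1 e1 subrr.
  have -> : C l n x3 = C l n x1 + (x3 - x1) *
      (l * (2 * (l * x1 + n) + a1 * x1 + a3)
       - (3 * x1 ^+ 2 + 2 * a2 * x1 + a4 - a1 * (l * x1 + n))).
    rewrite /C /x3; ring.
  by rewrite c1 l1 hl subrr mulr0 addr0.
Qed.

Definition addp (P Q : point E) : point E :=
  Point (add_raw_oncurve (point_oncurve P) (point_oncurve Q)).

Definition mulp (n : nat) (P : point E) : point E := iter n (addp P) point0.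

(* Homogeneous coordinates in the projective plane. *)
Definition pcoord (P : point E) : 'I_3 -> F :=
  if point_val P is Some (x, y) then
    fun i => [:: x; y; 1]`_i
  else fun i => [:: 0; 1; 0]`_i.
End GroupLaw.

(* E[p] is trivial over an algebraically closed field of characteristic p. *)
Definition supersingular (K : closedFieldType) (E : ellcurve K) : Prop :=
  exists2 p, p \in [pchar K] &
    forall P : point E, mulp p P = point0 E -> P = point0 E.

(* Morphism of projective plane curves: near every point, f is given by three
   forms of the same degree without common zero. *)
Definition regular_map (K : closedFieldType) (E E' : ellcurve K)
    (f : point E -> point E') : Prop :=
  forall P : point E, exists (d : nat) (G : 'I_3 -> {mpoly K[3]}),
    [/\ forall i, G i \is d.-homog,
        exists i, (G i).@[pcoord P] != 0
      & forall Q : point E, (exists i, (G i).@[pcoord Q] != 0) ->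
          exists2 c : K, c != 0 &
            forall i, (G i).@[pcoord Q] = c * pcoord (f Q) i].

Record isogeny (K : closedFieldType) (E E' : ellcurve K) := Isogeny {
  isog_fun :> point E -> point E';
  isog_regular : regular_map isog_fun;
  isog_add : {morph isog_fun : P Q / addp P Q};
  isog_nonconst : exists P Q, isog_fun P <> isog_fun Q
}.

Definition isog_ker (K : closedFieldType) (E E' : ellcurve K)
    (psi : isogeny E E') (P : point E) : Prop := psi P = point0 E'.

Section Frobenius.
Variables (F : finFieldType) (K : closedFieldType) (iota : {rmorphism F -> K}).
Variable E : ellcurve F.

Definition frob_raw (P : option (K * K)) : option (K * K) :=
  if P is Some (x, y) then Some (x ^+ #|F|, y ^+ #|F|) else None.

Lemma frob_raw_oncurve (P : option (K * K)) :
  oncurve (base_change iota E) P -> oncurve (base_change iota E) (frob_raw P).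
Proof.
case: P => [[x y]|] //= /eqP e; apply/eqP.
have D (u v : K) : (u + v) ^+ #|F| = u ^+ #|F| + v ^+ #|F|.
  apply: exprDn_pchar; have [p pr_p chF] := finPcharP F.
  have chK : p \in [pchar K] by rewrite (fmorph_pchar iota).
  rewrite (card_pprimeChar chF) pnatX pnatE //.
  by rewrite chK.
have iX (a : F) : iota a ^+ #|F| = iota a by rewrite -rmorphXn /= expf_card.
by have := congr1 (fun z => z ^+ #|F|) e; rewrite !(D, exprMn, iX).
Qed.

Definition frob (P : point (base_change iota E)) : point (base_change iota E) :=
  Point (frob_raw_oncurve (point_oncurve P)).

(* A set S of geometric points is defined over the extension of degree m of F:
   the image of S under the m-th power of Frobenius is S. *)
Definition defined_over_ext (m : nat) (S : point (base_change iota E) -> Prop) :=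
  forall Q, (exists2 P, S P & iter m frob P = Q) <-> S Q.
End Frobenius.

(* Main.v *)
(* Over the algebraic closure write E as y^2 = x^3 + Ax + B. If x(aP) = U(x)/V(x) in
   lowest terms, call the larger of the degrees of U and V the degree of the map a. The
   symmetric functions of x(P + Q), x(P - Q) are biquadratic forms in x(P), x(Q) without
   common zero, which gives the parallelogram law deg(a + b) + deg(a - b) = 2 deg a +
   2 deg b (Manin), whence deg [n] = n^2.
   If E[p] = 0 then V is constant for a = [p], so x o [p] is an injective polynomial of
   degree p^2, i.e. x([p]P) = c x^(p^2) + d, and d = 0 because [p] fixes the 2-torsion.
   Iterating, x([p^k]P) = C x^(p^(2k)) with C^2 = 1 if A != 0 and C^3 = 1 if B != 0. So
   a power of the q-Frobenius pi is, pointwise up to sign, a multiplication by an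
   integer, and such maps preserve every kernel; a power of pi fixes each given point,
   so images are equal to, not just contained in, the kernel.
   For odd e we also need C = 1. Otherwise pi^2 = - s [q] for a scaling automorphism
   s <> 1, -1, and multiplicativity applied to (1 + pi)(1 - pi) = 1 + s[q] yields
   (deg(1 + pi) - deg(1 - pi))^2 = 4 deg(1 - s) q with 1 <= deg(1 - s) <= 4 < p, which
   is absurd since q is an odd power of p. *)
Require Import Defs.
From HB Require Import structures.
From mathcomp Require Import all_boot all_order all_algebra all_fingroup all_field.
From mathcomp Require Import ring zify.

Set Implicit Arguments.
Unset Strict Implicit.
Unset Printing Implicit Defensive.

Import GRing.Theory.
Local Open Scope ring_scope.

(** * The group law of a short Weierstrass curve *)

Record short_curve (K : fieldType) := ShortCurve {
  sA : K; sB : K;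
  short_disc : 4 * sA ^+ 3 + 27 * sB ^+ 2 != 0;
  short_two : (2 : K) != 0
}.

Section ShortGroup.
Variables (K : fieldType) (C : short_curve K).
Notation A := (sA C).
Notation B := (sB C).

Definition on_short (P : option (K * K)) :=
  if P is Some (x, y) then y ^+ 2 == x ^+ 3 + A * x + B else true.

(** The third intersection of the line with the curve, reflected in the axis of abscissae. *)
Definition sline (l x1 y1 x2 : K) : option (K * K) :=
  Some (l ^+ 2 - x1 - x2, l * (2 * x1 + x2 - l ^+ 2) - y1).

Definition slope (x1 y1 x2 y2 : K) : K :=
  if x1 == x2 then (3 * x1 ^+ 2 + A) / (2 * y1) else (y2 - y1) / (x2 - x1).

Definition sadd_raw (P Q : option (K * K)) : option (K * K) :=
  match P, Q with
  | None, _ => Q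
  | _, None => P
  | Some (x1, y1), Some (x2, y2) =>
    if (x1 == x2) && (y1 == - y2) then None
    else sline (slope x1 y1 x2 y2) x1 y1 x2
  end.

Definition sopp_raw (P : option (K * K)) : option (K * K) :=
  if P is Some (x, y) then Some (x, - y) else None.

(* The line of slope l through (x1, y1) meets the curve in x1, x2 and
   l ^+ 2 - x1 - x2: comparison of the coefficients of x. *)
Definition meets (l x1 y1 x2 y2 : K) :=
  y2 = y1 + l * (x2 - x1) /\
  A = 2 * l * (y1 - l * x1) + x1 * x2 + (x1 + x2) * (l ^+ 2 - x1 - x2).

Lemma same_abscissa x y1 y2 :
  on_short (Some (x, y1)) -> on_short (Some (x, y2)) -> y1 = y2 \/ y1 = - y2.
Proof.
move=> /eqP e1 /eqP e2; have /eqP : (y1 - y2) * (y1 + y2) = 0.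
  by rewrite -subr_sqr e1 e2 subrr.
rewrite mulf_eq0 subr_eq0 addr_eq0 => /orP[] /eqP; [by left|by right].
Qed.

Lemma double_neq0 (y : K) : y != - y -> y != 0 /\ 2 * y != 0.
Proof.
move=> h; have y0 : y != 0 by apply: contraNneq h => ->; rewrite oppr0.
by rewrite mulf_neq0 // short_two.
Qed.

Lemma slope_meets x1 y1 x2 y2 :
  on_short (Some (x1, y1)) -> on_short (Some (x2, y2)) ->
  ~~ ((x1 == x2) && (y1 == - y2)) -> meets (slope x1 y1 x2 y2) x1 y1 x2 y2.
Proof.
move=> c1 c2; rewrite /slope; case: eqVneq => [ex|nx] /=.
  subst x2; case: (same_abscissa c1 c2) => ey ny; last by rewrite ey eqxx in ny.
  subst y2; have [y0 y20] := double_neq0 ny.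
  split; first by ring.
  by have t0 := short_two C; field; rewrite t0 y0.
move=> _; have d0 : x2 - x1 != 0 by rewrite subr_eq0 eq_sym.
move/eqP: c1 => c1; move/eqP: c2 => c2.
split; first by rewrite divfK // addrC subrK.
(* Subtracting the two curve equations eliminates B, and dividing by [x2 - x1] gives A. *)
have -> : A = (y2 ^+ 2 - y1 ^+ 2) / (x2 - x1) - x2 ^+ 2 - x1 * x2 - x1 ^+ 2.
  by rewrite c1 c2; field.
by field.
Qed.

(** Comparison of the constant terms. Together with [meets] it makes both coefficients of the curve
    polynomials in the slope and the coordinates. *)
Lemma meets_B l x1 y1 x2 y2 : on_short (Some (x1, y1)) ->
  meets l x1 y1 x2 y2 ->
  B = (y1 - l * x1) ^+ 2 - x1 * x2 * (l ^+ 2 - x1 - x2).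
Proof.
move=> /eqP c1 [_ hA]; have -> : B = y1 ^+ 2 - x1 ^+ 3 - A * x1 by rewrite c1; ring.
by rewrite hA; ring.
Qed.

(** [meets] determines the slope, for a chord and for a tangent alike, so a sum can be computed from
    any slope that satisfies it. *)
Lemma sadd_meets l x1 y1 x2 y2 :
  on_short (Some (x1, y1)) -> on_short (Some (x2, y2)) ->
  ~~ ((x1 == x2) && (y1 == - y2)) -> meets l x1 y1 x2 y2 ->
  sadd_raw (Some (x1, y1)) (Some (x2, y2)) = sline l x1 y1 x2.
Proof.
move=> c1 c2 nO [h1 h2] /=; rewrite (negbTE nO); congr sline; move: nO.
rewrite /slope; case: eqVneq => [ex|nx] /= ny.
  subst x2; have ey : y2 = y1 by rewrite h1; ring.
  clear h1; subst y2; have [y0 y20] := double_neq0 ny; rewrite h2.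
  by have t0 := short_two C; field; rewrite t0 y0.
by rewrite h1; field; rewrite subr_eq0 eq_sym.
Qed.

Lemma sline_on l x1 y1 x2 y2 : on_short (Some (x1, y1)) ->
  meets l x1 y1 x2 y2 -> on_short (sline l x1 y1 x2).
Proof.
move=> c1 m; have hB := meets_B c1 m; case: m => _ hA.
by apply/eqP; rewrite hB hA; ring.
Qed.

Lemma sadd_on P Q : on_short P -> on_short Q -> on_short (sadd_raw P Q).
Proof.
case: P Q => [[x1 y1]|] [[x2 y2]|] // c1 c2 /=.
case: ifP => // /negbT nO.
exact: sline_on c1 (slope_meets c1 c2 nO).
Qed.

Lemma sopp_on P : on_short P -> on_short (sopp_raw P).
Proof. by case: P => [[x y]|] //=; rewrite sqrrN. Qed.

Lemma sadd_spec x1 y1 x2 y2 :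
  on_short (Some (x1, y1)) -> on_short (Some (x2, y2)) ->
  ~~ ((x1 == x2) && (y1 == - y2)) ->
  exists2 l, meets l x1 y1 x2 y2 &
    sadd_raw (Some (x1, y1)) (Some (x2, y2)) = sline l x1 y1 x2.
Proof.
move=> c1 c2 nO; have m := slope_meets c1 c2 nO.
by exists (slope x1 y1 x2 y2) => //; apply: sadd_meets.
Qed.

Lemma saddC P Q : on_short P -> on_short Q -> sadd_raw P Q = sadd_raw Q P.
Proof.
case: P Q => [[x1 y1]|] [[x2 y2]|] // c1 c2.
have [/andP[/eqP ex /eqP ey]|nO] := boolP ((x1 == x2) && (y1 == - y2)).
  by rewrite /= ex ey opprK !eqxx.
have [l [h1 h2] ->] := sadd_spec c1 c2 nO.
have m : meets l x2 y2 x1 y1 by split; [|rewrite {1}h2]; rewrite h1; ring.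
rewrite (sadd_meets c2 c1 _ m); last first.
  by rewrite (eq_sym x2) (eq_sym y2) eqr_oppLR.
by rewrite /sline h1; congr (Some (_, _)); ring.
Qed.

Lemma sadd0 P : sadd_raw P None = P. Proof. by case: P => [[]|]. Qed.

Lemma saddN P : sadd_raw (sopp_raw P) P = None.
Proof. by case: P => [[x y]|] //=; rewrite !eqxx. Qed.

Lemma sopp_add P Q : on_short P -> on_short Q ->
  sopp_raw (sadd_raw P Q) = sadd_raw (sopp_raw P) (sopp_raw Q).
Proof.
case: P Q => [[x1 y1]|] [[x2 y2]|] // c1 c2.
have [h|nO] := boolP ((x1 == x2) && (y1 == - y2)).
  by rewrite /= eqr_opp h.
have [l [h1 h2] ->] := sadd_spec c1 c2 nO.
have m : meets (- l) x1 (- y1) x2 (- y2) by split; [|rewrite {1}h2]; rewrite ?h1; ring.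
have c1' : on_short (Some (x1, - y1)) := sopp_on c1.
have c2' : on_short (Some (x2, - y2)) := sopp_on c2.
rewrite [sopp_raw (Some (x1, y1))]/= [sopp_raw (Some (x2, y2))]/=.
rewrite (sadd_meets c1' c2' _ m) ?eqr_opp //.
by rewrite /sline /=; congr (Some (_, _)); ring.
Qed.

Lemma disc_double x : x ^+ 3 + A * x + B = 0 -> 3 * x ^+ 2 + A <> 0.
Proof.
move=> h1 h2; have := short_disc C; rewrite -[X in X == _]subr0.
have hA : A = - (3 * x ^+ 2) by rewrite -[A]subr0 -h2; ring.
have hB : B = 2 * x ^+ 3 by rewrite -[B]subr0 -h1 hA; ring.
by rewrite subr0 hB hA => /eqP[]; ring.
Qed.

(** Cancellation is not yet available. An equality P + Q = Q with P affine forces the ordinate of Q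
    to be 0 and its abscissa to be a double root of the cubic. *)
Lemma sadd_neq x1 y1 Q : on_short (Some (x1, y1)) -> on_short Q ->
  sadd_raw (Some (x1, y1)) Q <> Q.
Proof.
case: Q => [[x2 y2]|] // c1 c2.
have [h|nO] := boolP ((x1 == x2) && (y1 == - y2)); first by rewrite /= h.
have [l m ->] := sadd_spec c1 c2 nO; have hB := meets_B c1 m; case: m => h1 h2 [hx hy].
have hl : x1 = l ^+ 2 - 2 * x2.
  transitivity (l ^+ 2 - x2 - (l ^+ 2 - x1 - x2)); [by ring|by rewrite hx; ring].
have y0 : y2 = 0.
  apply/eqP; have /eqP : 2 * y2 = 0.
    transitivity (y2 + y2); first by ring.
    by rewrite -{1}hy h1 hl; ring.
  by rewrite mulf_eq0 (negbTE (short_two C)).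
apply: (@disc_double x2).
  by move/eqP: c2 => <-; rewrite y0 expr0n.
have hy1 : y1 = - l * (x2 - x1).
  by apply/eqP; rewrite -subr_eq0 mulNr opprK -h1 y0.
by rewrite h2 hy1 hl; ring.
Qed.

(** The line through P + Q and -Q is the mirror image of the line through P and Q, with slope [- l];
    [sadd_neq] excludes the degenerate case P + Q = Q. *)
Lemma saddK P Q : on_short P -> on_short Q ->
  sadd_raw (sadd_raw P Q) (sopp_raw Q) = P.
Proof.
case: P Q => [[x1 y1]|] [[x2 y2]|] // c1 c2; last first.
  exact: etrans (saddC c2 (sopp_on c2)) (saddN _).
have c2' : on_short (Some (x2, - y2)) := sopp_on c2.
have [/andP[/eqP ex /eqP ey]|nO] := boolP ((x1 == x2) && (y1 == - y2)).
  by rewrite /= ex ey !eqxx.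
have nS := sadd_neq c1 c2.
have [l m eS] := sadd_spec c1 c2 nO; have cS := sline_on c1 m.
rewrite eS in nS *; case: m => h1 h2.
rewrite /sline [sopp_raw _]/=.
have m' : meets (- l) (l ^+ 2 - x1 - x2) (l * (2 * x1 + x2 - l ^+ 2) - y1) x2 (- y2).
  by split; [|rewrite {1}h2]; rewrite ?h1; ring.
rewrite (sadd_meets cS c2' _ m'); first by rewrite /sline; congr (Some (_, _)); ring.
apply/negP => /andP[/eqP ex /eqP ey]; apply: nS.
by rewrite /sline ex ey opprK.
Qed.

(** Two lines of equal slope through the second point coincide, so the third point is the first one
    or the remaining intersection. *)
Lemma sadd_assoc_same_slope l x1 y1 x2 y2 x3 y3 :
  meets l x1 y1 x2 y2 -> meets l x2 y2 x3 y3 ->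
  x3 = x1 /\ y3 = y1 \/ x3 = l ^+ 2 - x1 - x2 /\ y3 = y1 + l * (x3 - x1).
Proof.
move=> [h1 h2] [h3 h4]; have y31 : y3 = y1 + l * (x3 - x1) by rewrite h3 h1; ring.
have /eqP : (x3 - x1) * (x3 - (l ^+ 2 - x1 - x2)) = 0.
  transitivity (A - A); last by rewrite subrr.
  by rewrite {1}h2 h4 h1; ring.
rewrite mulf_eq0 !subr_eq0 => /orP[] /eqP ex; last by right.
by left; split=> //; rewrite y31 ex; ring.
Qed.

Section Generic.
Variables x1 y1 x2 y2 x3 y3 l m : K.
Let xS := l ^+ 2 - x1 - x2.
Let yS := l * (2 * x1 + x2 - l ^+ 2) - y1.
Let xT := m ^+ 2 - x2 - x3.
Let yT := m * (2 * x2 + x3 - m ^+ 2) - y2.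
Hypotheses (hl : meets l x1 y1 x2 y2) (hm : meets m x2 y2 x3 y3).

(* Equating the two expressions of A expresses y2 rationally in x1, x2, x3, l and m,
   which are then free: associativity becomes an identity of rational functions. *)
Lemma sadd_assoc_chords : l != m -> x3 != xS -> x1 != xT ->
  sline ((y3 - yS) / (x3 - xS)) xS yS x3 = sline ((y1 - yT) / (x1 - xT)) xT yT x1.
Proof.
move=> lm nS nT; have lm0 : l - m != 0 by rewrite subr_eq0.
have s1 : x1 + x2 + x3 - l ^+ 2 != 0.
  by move: nS; rewrite -subr_eq0 /xS (_ : _ - _ = x1 + x2 + x3 - l ^+ 2) //; ring.
have s2 : x1 + x2 + x3 - m ^+ 2 != 0.
  by move: nT; rewrite -subr_eq0 /xT (_ : _ - _ = x1 + x2 + x3 - m ^+ 2) //; ring.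
have t0 := short_two C; case: hl hm => h1 h2 [h3 h4].
have ey1 : y1 = y2 - l * (x2 - x1) by rewrite h1; ring.
have ey2 : y2 = (x2 * x3 + (x2 + x3) * (m ^+ 2 - x2 - x3) - x1 * x2
    - (x1 + x2) * (l ^+ 2 - x1 - x2) + 2 * l ^+ 2 * x2 - 2 * m ^+ 2 * x2) / (2 * (l - m)).
  have e : 2 * (l - m) * y2 = x2 * x3 + (x2 + x3) * (m ^+ 2 - x2 - x3) - x1 * x2
    - (x1 + x2) * (l ^+ 2 - x1 - x2) + 2 * l ^+ 2 * x2 - 2 * m ^+ 2 * x2.
    apply/eqP; rewrite -subr_eq0; apply/eqP; transitivity (A - A); last by rewrite subrr.
    by rewrite {1}h2 h4 ey1; ring.
  by rewrite -e [_ * y2]mulrC mulfK // mulf_neq0.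
rewrite /sline /yS /yT /xS /xT h3 ey1 ey2.
congr (Some (_, _)).
  by field; rewrite !subr_eq0 nT lm t0 nS.
by field; rewrite !subr_eq0 nT lm t0 nS.
Qed.

(** The case R = P + Q, where adding R to P + Q is a doubling. Equating the two expressions of [y3]
    expresses [y1] by [x1], [x2], [l] and [m]. *)
Lemma sadd_assoc_tangent : x3 = xS -> y3 = yS -> x1 != xT -> y3 != 0 ->
  sline ((3 * x3 ^+ 2 + A) / (2 * y3)) x3 y3 x3 = sline ((y1 - yT) / (x1 - xT)) xT yT x1.
Proof.
move=> ex ey nT ny; have t0 := short_two C; case: hl hm => h1 h2 [h3 _].
have ey1 : y1 = (l * (3 * x1 - l ^+ 2) - m * (l ^+ 2 - x1 - 2 * x2)) / 2.
  have e : 2 * y1 = l * (3 * x1 - l ^+ 2) - m * (l ^+ 2 - x1 - 2 * x2).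
    apply/eqP; rewrite -subr_eq0; apply/eqP; transitivity (y3 - y3); last by rewrite subrr.
    by rewrite {1}h3 ey /yS h1 ex /xS; ring.
  by rewrite -e [_ * y1]mulrC mulfK.
move: nT ny; rewrite /yT h2 ey /yS h1 /xT ex /xS ey1 => nT ny.
have nT' : x1 - (m ^+ 2 - x2 - (l ^+ 2 - x1 - x2)) != 0 by rewrite subr_eq0.
have ny' : l * (2 * x1 + x2 - l ^+ 2) * 2
    - (l * (3 * x1 - l ^+ 2) - m * (l ^+ 2 - x1 - 2 * x2)) != 0.
  apply: contra_neq ny => e; apply: (mulIf t0); rewrite mul0r -[RHS]e.
  by rewrite mulrBl divfK.
by rewrite /sline; congr (Some (_, _)); field; rewrite nT' ny' t0.
Qed.

(** The case R = P + Q with Q of order 2, in which associativity reduces to 2R = 2P. *)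
Lemma sadd_assoc_two_torsion : x3 = xS -> y3 = yS -> y2 = 0 -> y1 != 0 -> y3 != 0 ->
  sline ((3 * x3 ^+ 2 + A) / (2 * y3)) x3 y3 x3
  = sline ((3 * x1 ^+ 2 + A) / (2 * y1)) x1 y1 x1.
Proof.
move=> ex ey y20 n1 n3; have t0 := short_two C; case: hl => h1 h2.
have ey1 : y1 = l * (x1 - x2) by apply/eqP; rewrite -subr_eq0 -mulrN opprB -h1 y20.
move: n1 n3; rewrite h2 ey /yS ex /xS ey1 => n1 n3.
have /andP[l0 d0] : (l != 0) && (x1 - x2 != 0) by rewrite -negb_or -mulf_eq0.
by rewrite /sline; congr (Some (_, _)); field; rewrite n3 t0 l0 d0.
Qed.
End Generic.

Lemma sadd_sline (x1 y1 x2 y2 : K) : x1 != x2 ->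
  sadd_raw (Some (x1, y1)) (Some (x2, y2)) = sline ((y2 - y1) / (x2 - x1)) x1 y1 x2.
Proof. by move=> n /=; rewrite /slope (negbTE n). Qed.

Lemma sadd_double (x y : K) : y != 0 ->
  sadd_raw (Some (x, y)) (Some (x, y)) = sline ((3 * x ^+ 2 + A) / (2 * y)) x y x.
Proof.
move=> n /=; rewrite /slope !eqxx /=; case: eqP => // e.
have /eqP : 2 * y = 0 by rewrite mulr_natl mulr2n {1}e addNr.
by rewrite mulf_eq0 (negbTE n) (negbTE (short_two C)).
Qed.

Lemma sadd_eq0 P Q : on_short P -> on_short Q ->
  sadd_raw P Q = None -> Q = sopp_raw P.
Proof.
case: P Q => [[x1 y1]|] [[x2 y2]|] //= _ _.
by case: ifP => // /andP[/eqP -> /eqP ->]; rewrite opprK.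
Qed.

Lemma sopp_rawK P : sopp_raw (sopp_raw P) = P.
Proof. by case: P => [[x y]|] //=; rewrite opprK. Qed.

Lemma saddA_tangent P Q R : on_short P -> on_short Q -> on_short R ->
  P != None -> sadd_raw Q R != None -> sadd_raw P (sadd_raw Q R) != None ->
  sadd_raw P Q = R -> Q != None -> R != None -> sadd_raw R R != None ->
  sadd_raw R R = sadd_raw P (sadd_raw Q R).
Proof.
move=> cP cQ cR.
case: P cP => [[x1 y1]|] // c1 _; case: Q cQ => [[x2 y2]|] // c2 nT.
case: R cR nT => [[x3 y3]|] // c3 nT nPT eS _ _ nSR.
have nO : ~~ ((x1 == x2) && (y1 == - y2)) by apply/negP => h; rewrite /= h in eS.
have nO' : ~~ ((x2 == x3) && (y2 == - y3)) by apply/negP => h; rewrite /= h in nT.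
have [l ml eSl] := sadd_spec c1 c2 nO; have [m mm eT] := sadd_spec c2 c3 nO'.
have y30 : y3 != 0 by apply: contraNneq nSR => e; rewrite /= e oppr0 !eqxx.
move: (eSl); rewrite eS => -[ex ey].
rewrite sadd_double //.
case: (eqVneq x1 (m ^+ 2 - x2 - x3)) => [e|nx]; last first.
  by rewrite (saddC c1 (sadd_on c2 c3)) eT [RHS]sadd_sline 1?eq_sym //;
     apply: (sadd_assoc_tangent ml mm).
have cT := sline_on c2 mm.
have eP : sadd_raw (Some (x2, y2)) (Some (x3, y3)) = Some (x1, y1).
  rewrite eT in nPT *; rewrite /sline -e in nPT cT *.
  case: (same_abscissa c1 cT) => e' //; first by rewrite e'.
  by rewrite /= e' !eqxx in nPT.
have y10 : y1 != 0.
  by apply: contraNneq nPT => e'; rewrite eP /= e' oppr0 !eqxx.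
rewrite eP sadd_double //.
apply: (sadd_assoc_two_torsion ml ex ey) => //.
(* From P + Q = R and Q + R = P, both P - R and R - P equal Q; hence Q = -Q and its ordinate is
   0. *)
have e1 := saddK c2 c3; rewrite eP in e1.
have := saddK c2 c1; rewrite (saddC c2 c1) eS => e2.
have := sopp_add c1 (sopp_on c3); rewrite e1 sopp_rawK (saddC (sopp_on c1) c3) e2 => -[h].
have /eqP : 2 * y2 = 0 by rewrite mulr_natl mulr2n -{1}h addNr.
by rewrite mulf_eq0 (negbTE (short_two C)) => /eqP.
Qed.

(** Sums at infinity are settled by [saddK]. The inner sums need no further cases, as [meets] treats
    chords and tangents alike; the outer ones are chords unless P + Q = R or Q + R = P. *)
Lemma saddA P Q R : on_short P -> on_short Q -> on_short R ->
  sadd_raw P (sadd_raw Q R) = sadd_raw (sadd_raw P Q) R.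
Proof.
move=> cP cQ cR.
have cS := sadd_on cP cQ; have cT := sadd_on cQ cR.
case: (eqVneq P None) => [->|nP] //; case: (eqVneq Q None) => [->|nQ]; first by rewrite !sadd0.
case: (eqVneq R None) => [->|nR]; first by rewrite !sadd0.
case: (eqVneq (sadd_raw P Q) None) => [eS|nS].
  rewrite eS; have -> := sadd_eq0 cP cQ eS.
  rewrite (saddC cP) ?sadd_on ?sopp_on // (saddC (sopp_on cP) cR).
  by rewrite -{2}[P]sopp_rawK saddK // sopp_on.
case: (eqVneq (sadd_raw Q R) None) => [eT|nT].
  by rewrite eT sadd0 (sadd_eq0 cQ cR eT) saddK.
case: (eqVneq (sadd_raw (sadd_raw P Q) R) None) => [e|nSR].
  rewrite e (sadd_eq0 cS cR e) sopp_add // (saddC cQ) ?sadd_on ?sopp_on //.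
  rewrite -{2}[Q]sopp_rawK saddK ?sopp_on //.
  by rewrite (saddC cP) ?sopp_on // saddN.
case: (eqVneq (sadd_raw P (sadd_raw Q R)) None) => [e|nPT].
  rewrite e; have eP : P = sadd_raw (sopp_raw R) (sopp_raw Q).
    by rewrite -[P]sopp_rawK -(sopp_add cR cQ) (saddC cR cQ) (sadd_eq0 cP cT e) sopp_rawK.
  by rewrite eP -{2}[Q]sopp_rawK saddK ?sopp_on // saddN.
case: (eqVneq (sadd_raw P Q) R) => [eS|nSR'].
  by rewrite eS (@saddA_tangent P Q R) // -{1}eS.
case: (eqVneq (sadd_raw Q R) P) => [eT|nPT'].
  rewrite eT (saddC cS cR) (saddC cP cQ) (@saddA_tangent R Q P) //.
  - by rewrite (saddC cQ cP).
  - by rewrite (saddC cQ cP) (saddC cR cS).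
  - by rewrite saddC.
  - by rewrite -{1}eT saddC // eT.
move: nS nT nSR nPT nSR' nPT'.
case: P nP cP cS => [[x1 y1]|] // _ c1 cS; case: Q nQ cQ cS cT => [[x2 y2]|] // _ c2 cS cT.
case: R nR cR cT => [[x3 y3]|] // _ c3 cT nS nT.
have nO : ~~ ((x1 == x2) && (y1 == - y2)) by apply/negP => h; rewrite /= h in nS.
have nO' : ~~ ((x2 == x3) && (y2 == - y3)) by apply/negP => h; rewrite /= h in nT.
have [l ml eS] := sadd_spec c1 c2 nO; have [m mm eT] := sadd_spec c2 c3 nO'.
rewrite eS in cS nS *; rewrite eT in cT nT *; rewrite /sline in cS cT *.
set xS := l ^+ 2 - x1 - x2 in cS *; set yS := _ - y1 in cS *.
set xT := m ^+ 2 - x2 - x3 in cT *; set yT := _ - y2 in cT *.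
move=> nSR nPT nSR' nPT'.
have n1 : x3 != xS.
  apply/eqP => ex; move: c3 nSR nSR'; rewrite ex => c3.
  by case: (same_abscissa cS c3) => -> /=; rewrite !eqxx.
have n2 : x1 != xT.
  apply/eqP => ex; move: c1 nPT nPT'; rewrite ex => c1.
  by case: (same_abscissa c1 cT) => -> /=; rewrite !eqxx.
case: (eqVneq l m) => [elm|lm]; last first.
  rewrite (saddC c1 cT) !sadd_sline 1?eq_sym // ; apply/esym.
  exact: (sadd_assoc_chords ml mm).
(* With equal slopes all points lie on one line and R = P is the only possibility left;
   commutativity then suffices. *)
subst m; case: (sadd_assoc_same_slope ml mm) => -[e1 e2]; last by rewrite e1 eqxx in n1.
have e : sline l x1 y1 x2 = sline l x2 y2 x3.
  by rewrite -eS -eT e1 e2 saddC.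
rewrite (saddC cS c3) e1 e2; congr sadd_raw; apply/esym; exact: e.
Qed.

End ShortGroup.

(** * The points as an abelian group *)

Record spoint (K : fieldType) (C : short_curve K) := SPoint {
  spoint_val : option (K * K);
  spoint_on : on_short C spoint_val
}.

HB.instance Definition _ (K : fieldType) (C : short_curve K) :=
  [isSub for @spoint_val K C].
HB.instance Definition _ (K : fieldType) (C : short_curve K) :=
  [Choice of spoint C by <:].

Section ShortZmodule.
Variables (K : fieldType) (C : short_curve K).

Definition spoint0 : spoint C := @SPoint K C None isT.
Definition sadd (P Q : spoint C) := SPoint (sadd_on (spoint_on P) (spoint_on Q)).
Definition sopp (P : spoint C) := SPoint (sopp_on (spoint_on P)).

Fact sadd_associative : associative sadd.
Proof. by move=> P Q R; apply/val_inj/saddA; apply: spoint_on. Qed.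
Fact sadd_commutative : commutative sadd.
Proof. by move=> P Q; apply/val_inj/saddC; apply: spoint_on. Qed.
Fact sadd0_left : left_id spoint0 sadd.
Proof. by move=> P; apply/val_inj. Qed.
Fact saddN_left : left_inverse spoint0 sopp sadd.
Proof. by move=> P; apply/val_inj/saddN. Qed.

HB.instance Definition _ :=
  GRing.isZmodule.Build (spoint C) sadd_associative sadd_commutative
    sadd0_left saddN_left.
End ShortZmodule.

(** * Abscissae of sums and differences *)

(* Up to a common factor, these are the products Z Z', X Z' + X' Z and X X' of the
   projective abscissae (X : Z), (X' : Z') of P + Q and P - Q, as forms in the
   projective abscissae (x : z) of P and (x' : z') of Q. *)
Section Forms.
Variables (R : comNzRingType) (a b : R).
Definition bq0 (x z x' z' : R) := (x * z' - x' * z) ^+ 2.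
Definition bq1 (x z x' z' : R) :=
  2 * (x * x' + a * z * z') * (x * z' + x' * z) + 4 * b * (z * z') ^+ 2.
Definition bq2 (x z x' z' : R) :=
  (x * x' - a * z * z') ^+ 2 - 4 * b * z * z' * (x * z' + x' * z).
End Forms.

Section Kummer.
Variables (K : fieldType) (C : short_curve K).
Notation A := (sA C).
Notation B := (sB C).

(** [(xc P : zc P)] is the projective abscissa, normalised to (x : 1) for affine points and to (1 :
    0) at infinity. *)
Definition xc (P : spoint C) : K := if val P is Some (x, _) then x else 1.
Definition zc (P : spoint C) : K := if val P is Some _ then 1 else 0.

Lemma xz_neq0 P : (xc P != 0) || (zc P != 0).
Proof. by rewrite /xc /zc; case: (val P) => [[x y]|]; rewrite oner_neq0 ?orbT. Qed.

(** [bq0] vanishes only at equal abscissae. If these are finite, equal to r, then [bq1] is a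
    multiple of f(r) and, once f(r) = 0, [bq2] is a multiple of f'(r)^2, where f = x^3 + Ax + B has
    no double root; at infinity [bq2] is nonzero. *)
Lemma bq_neq0 (x z x' z' : K) :
  (x != 0) || (z != 0) -> (x' != 0) || (z' != 0) ->
  [|| bq0 x z x' z' != 0, bq1 A B x z x' z' != 0 | bq2 A B x z x' z' != 0].
Proof.
move=> n n'; rewrite -!negb_and; apply/negP => /and3P[/eqP h0 /eqP h1 /eqP h2].
have e : x * z' = x' * z.
  by apply/eqP; rewrite -subr_eq0 -sqrf_eq0 -/(bq0 x z x' z') h0.
have zz : z * z' != 0.
  rewrite mulf_eq0; apply/negP => /orP[] /eqP z0; move: n n' e h2;
    rewrite /bq2 z0 eqxx orbF ?(mulr0, mul0r, subr0) => n n' /eqP.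
  - rewrite mulf_eq0 (negbTE n) /= => /eqP z0'; move: n'.
    by rewrite z0' eqxx orbF => n' /eqP; rewrite expf_eq0 mulf_eq0 (negbTE n) (negbTE n').
  rewrite eq_sym mulf_eq0 (negbTE n') /= => /eqP z0'; move: n.
  by rewrite z0' eqxx orbF => n /eqP; rewrite ?mulr0 ?subr0 expf_eq0 mulf_eq0 (negbTE n) (negbTE n').
have /andP[z0 z0'] : (z != 0) && (z' != 0) by rewrite -negb_or -mulf_eq0.
set r := x / z; have ex : x = r * z by rewrite divfK.
have ex' : x' = r * z' by apply: (mulIf z0); rewrite -e ex; ring.
have zz2 : (z * z') ^+ 2 != 0 by rewrite expf_neq0.
have h : r ^+ 3 + A * r + B = 0.
  apply: (mulIf (_ : 2 * 2 * (z * z') ^+ 2 != 0)); first by rewrite !mulf_neq0 // short_two.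
  by rewrite mul0r -[RHS]h1 ex ex' /bq1; ring.
have h' : (3 * r ^+ 2 + A) ^+ 2 = 0.
  apply: (mulIf zz2); rewrite mul0r -[RHS]h2 ex ex' /bq2.
  have -> : B = - (r ^+ 3 + A * r) by rewrite -[LHS]subr0 -h; ring.
  by ring.
by apply: (disc_double h); apply/eqP; rewrite -sqrf_eq0 h'.
Qed.

Definition sum_diff_forms (l : K) (P Q S D : spoint C) :=
  [/\ bq0 (xc P) (zc P) (xc Q) (zc Q) = l * (zc S * zc D),
      bq1 A B (xc P) (zc P) (xc Q) (zc Q) = l * (xc S * zc D + xc D * zc S)
    & bq2 A B (xc P) (zc P) (xc Q) (zc Q) = l * (xc S * xc D)].

Lemma xcN P : xc (- P) = xc P. Proof. by case: P => [[[x y]|] c]. Qed.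
Lemma zcN P : zc (- P) = zc P. Proof. by case: P => [[[x y]|] c]. Qed.

Lemma sum_diff_double (P : spoint C) : exists2 l : K, l != 0 & sum_diff_forms l P P (P + P) 0.
Proof.
have t0 := short_two C.
case: P => [[[x y]|] c]; last first.
  by exists 1; rewrite ?oner_neq0 //; split; rewrite /bq0 /bq1 /bq2 /xc /zc /=; ring.
have c' : y ^+ 2 = x ^+ 3 + A * x + B by move: (c) => /eqP.
case: (eqVneq y 0) => [y0|ny]; last first.
  exists (4 * y ^+ 2); first by rewrite (_ : 4 = 2 * 2) ?mulf_neq0 ?expf_neq0 //; ring.
  have eS : val (SPoint c + SPoint c) = sline ((3 * x ^+ 2 + A) / (2 * y)) x y x.
    exact: sadd_double.
  rewrite /sum_diff_forms /xc /zc eS /=.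
  have eB : B = y ^+ 2 - (x ^+ 3 + A * x) by rewrite c'; ring.
  by split; rewrite /bq0 /bq1 /bq2 ?eB; field; rewrite ?ny ?t0.
have eS : val (SPoint c + SPoint c) = None by rewrite /= y0 oppr0 !eqxx.
(* For a point of order 2 both sum and difference are at infinity, so only [bq2] survives and is
   itself the factor. *)
exists (bq2 A B x 1 x 1).
  have := @bq_neq0 x 1 x 1; rewrite oner_neq0 orbT => /(_ isT isT).
  have -> : bq0 x 1 x 1 = 0 by rewrite /bq0; ring.
  have -> : bq1 A B x 1 x 1 = 0; last by rewrite eqxx.
  by transitivity (4 * y ^+ 2); [rewrite /bq1 c'|rewrite y0]; ring.
rewrite /sum_diff_forms /xc /zc eS /=; split; rewrite /bq0 ?mulr0 ?mulr1 ?addr0 //.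
  by ring.
by transitivity (4 * y ^+ 2); [rewrite /bq1 c'|rewrite y0]; ring.
Qed.

(** The cases P = Q and P = -Q reduce to doubling. For distinct finite abscissae the factor is the
    common denominator [(x2 - x1) ^+ 2], and the two curve equations eliminate A and B. *)
Lemma sum_diff P Q : exists2 l : K, l != 0 & sum_diff_forms l P Q (P + Q) (P - Q).
Proof.
have [eqPQ|nPQ] := eqVneq P Q.
  by subst Q; rewrite subrr; apply: sum_diff_double.
have [eqPQ|nPQ'] := eqVneq P (- Q).
  have -> : Q = - P by rewrite eqPQ opprK.
  have [l l0 [h0 h1 h2]] := sum_diff_double P; exists l => //.
  rewrite /sum_diff_forms !xcN !zcN opprK subrr; split.
  - by rewrite h0 mulrC; ring.
  - by rewrite h1; ring.
  - by rewrite h2; ring.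
case: (eqVneq P 0) => [->|nP].
  exists 1; rewrite ?oner_neq0 // add0r sub0r /sum_diff_forms xcN zcN.
  by split; rewrite /bq0 /bq1 /bq2 /xc /zc /=; ring.
case: (eqVneq Q 0) => [->|nQ].
  exists 1; rewrite ?oner_neq0 // addr0 subr0 /sum_diff_forms.
  by split; rewrite /bq0 /bq1 /bq2 /xc /zc /=; ring.
move: nP nQ nPQ nPQ'; case: P => [[[x1 y1]|] c1]; last by rewrite -val_eqE.
case: Q => [[[x2 y2]|] c2] _; last by rewrite -val_eqE.
rewrite -!val_eqE => _ /= n n'.
have nx : x1 != x2.
  apply: contra n => /eqP ex; move: c1 c2 n' ex => c1 c2 n' ex; subst x2.
  by case: (same_abscissa c1 c2) => ey; move: n'; rewrite ey !eqxx.
have d0 : x2 - x1 != 0 by rewrite subr_eq0 eq_sym.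
exists ((x2 - x1) ^+ 2); first by rewrite expf_neq0.
have eS : val (SPoint c1 + SPoint c2) = _ := sadd_sline C y1 y2 nx.
have eD : val (SPoint c1 - SPoint c2) = _ := sadd_sline C y1 (- y2) nx.
have e1 : y1 ^+ 2 = x1 ^+ 3 + A * x1 + B by move: (c1) => /eqP.
have e2 : y2 ^+ 2 = x2 ^+ 3 + A * x2 + B by move: (c2) => /eqP.
have eA : A = (y2 ^+ 2 - y1 ^+ 2) / (x2 - x1) - x2 ^+ 2 - x1 * x2 - x1 ^+ 2.
  by rewrite e1 e2; field.
have eB : B = y1 ^+ 2 - x1 ^+ 3 - A * x1 by rewrite e1; ring.
rewrite /sum_diff_forms /xc /zc eS eD /= /bq0 /bq1 /bq2 eB eA.
by split; field.
Qed.
End Kummer.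

(** * Polynomials with prescribed top coefficient *)

Section TopCoef.
Variable K : fieldType.
Implicit Types p q r : {poly K}.

(** A polynomial of formal degree n with its value c at infinity; c may be 0. *)
Definition top n p c := (size p <= n.+1)%N /\ p`_n = c.

Lemma topM n m k p q a b : top m p a -> top k q b -> n = (m + k)%N ->
  top n (p * q) (a * b).
Proof.
move=> [sp <-] [sq <-] ->; split.
  apply: leq_trans (size_polyMleq _ _) _; move: sp sq; lia.
have hm : (m < (m + k).+1)%N by rewrite ltnS leq_addr.
rewrite coefM (bigD1 (Ordinal hm)) //= addKn big1 ?addr0 // => i ne.
have {}ne : nat_of_ord i != m by apply: contra ne => /eqP e; apply/eqP/val_inj.
have [lt|ge] := ltnP i m.
  by rewrite [q`_ _]nth_default ?mulr0 //; apply: leq_trans sq _; move: (ltn_ord i); lia.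
by rewrite nth_default ?mul0r //; apply: leq_trans sp _; move: ne ge; lia.
Qed.

Lemma topD n p q a b : top n p a -> top n q b -> top n (p + q) (a + b).
Proof.
move=> [sp <-] [sq <-]; split; last by rewrite coefD.
by apply: leq_trans (size_polyD _ _) _; rewrite geq_max sp.
Qed.

Lemma topN n p a : top n p a -> top n (- p) (- a).
Proof. by move=> [sp <-]; split; rewrite ?size_polyN // coefN. Qed.

Lemma topC c : top 0 c%:P c.
Proof. by split; [exact: size_polyC_leq1|rewrite coefC]. Qed.

Lemma top_nat n : top 0 n%:R n%:R.
Proof. by rewrite -[n%:R in X in top _ X]polyC_natr; apply: topC. Qed.

Lemma top_size n p c : top n p c -> c != 0 -> size p = n.+1.
Proof.
move=> [sp <-] n0; apply/eqP; rewrite eqn_leq sp /= ltnNge.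
by apply: contra n0 => s; rewrite nth_default.
Qed.

(** If the values at infinity are not all 0, the formal degree is the largest of the three
    degrees. *)
Lemma top_unique3 n m p q r a b c a' b' c' :
  top n p a -> top n q b -> top n r c -> [|| a != 0, b != 0 | c != 0] ->
  top m p a' -> top m q b' -> top m r c' -> [|| a' != 0, b' != 0 | c' != 0] ->
  n = m.
Proof.
wlog: n m a b c a' b' c' / (n <= m)%N.
  move=> H hp hq hr h hp' hq' hr' h'; case: (leqP n m) => [le|/ltnW le].
    exact: (H _ _ _ _ _ _ _ _ le hp hq hr h hp' hq' hr' h').
  exact/esym/(H _ _ _ _ _ _ _ _ le hp' hq' hr' h' hp hq hr h).
move=> le [sp _] [sq _] [sr _] _ hp hq hr /or3P h; apply/eqP; rewrite eqn_leq le /= -ltnS.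
by case: h => h0; rewrite -?(top_size hp h0) -?(top_size hq h0) -?(top_size hr h0).
Qed.

Lemma top_exists2 p q : (p != 0) || (q != 0) ->
  exists n, [/\ (size p <= n.+1)%N, (size q <= n.+1)%N & (p`_n != 0) || (q`_n != 0)].
Proof.
move=> h; exists (maxn (size p) (size q)).-1.
have h0 : (0 < maxn (size p) (size q))%N by rewrite leq_max !lt0n !size_poly_eq0.
rewrite prednK // leq_maxl leq_maxr; split=> //.
rewrite /maxn in h0 *; case: ifP h0 => _ h0; apply/orP; [right|left];
  by rewrite -/(lead_coef _) lead_coef_eq0 -size_poly_eq0 -lt0n.
Qed.
End TopCoef.

Lemma rmorph_bq (R S : comNzRingType) (f : {rmorphism R -> S}) a b x z x' z' :
  [/\ f (bq0 x z x' z') = bq0 (f x) (f z) (f x') (f z'),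
      f (bq1 a b x z x' z') = bq1 (f a) (f b) (f x) (f z) (f x') (f z')
    & f (bq2 a b x z x' z') = bq2 (f a) (f b) (f x) (f z) (f x') (f z')].
Proof. by split; rewrite /bq0 /bq1 /bq2; ring. Qed.

Lemma horner_bq (R : comNzRingType) (a b x : R) (p q r s : {poly R}) :
  [/\ (bq0 p q r s).[x] = bq0 p.[x] q.[x] r.[x] s.[x],
      (bq1 a%:P b%:P p q r s).[x] = bq1 a b p.[x] q.[x] r.[x] s.[x]
    & (bq2 a%:P b%:P p q r s).[x] = bq2 a b p.[x] q.[x] r.[x] s.[x]].
Proof.
have [e0 e1 e2] := rmorph_bq (horner_eval x) a%:P b%:P p q r s.
by split; [apply: etrans e0 _|apply: etrans e1 _|apply: etrans e2 _];
   rewrite /= !horner_evalE ?hornerC.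
Qed.

Section TopForms.
Variables (K : fieldType) (A B : K).

(** Evaluation at infinity commutes with the forms, which have degree 2 in each pair of
    variables. *)
Lemma top_bq h k (U V U' V' : {poly K}) u v u' v' n :
  top h U u -> top h V v -> top k U' u' -> top k V' v' -> n = (h + k + (h + k))%N ->
  [/\ top n (bq0 U V U' V') (bq0 u v u' v'),
      top n (bq1 A%:P B%:P U V U' V') (bq1 A B u v u' v')
    & top n (bq2 A%:P B%:P U V U' V') (bq2 A B u v u' v')].
Proof.
move=> hU hV hU' hV' ->.
have T (p q : {poly K}) (a b : K) : top (h + k) p a -> top (h + k) q b ->
    top (h + k + (h + k)) (p * q) (a * b).
  by move=> hp hq; exact: topM hp hq (erefl _).
have T0 m (c : K) (p : {poly K}) (a : K) : top m p a -> top m (c%:P * p) (c * a).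
  by move=> hp; exact: topM (topC c) hp (erefl _).
have N0 m c (p : {poly K}) (a : K) : top m p a -> top m (c%:R * p) (c%:R * a).
  move=> hp; exact: topM (@top_nat K c) hp (erefl _).
have UU := topM hU hU' (erefl (h + k)%N).
have VV := topM hV hV' (erefl (h + k)%N).
have UV := topM hU hV' (erefl (h + k)%N).
have VU := topM hU' hV (addnC h k).
have AV := topM (T0 _ A _ _ hV) hV' (erefl (h + k)%N).
have BV := topM (T0 _ B _ _ hV) hV' (erefl (h + k)%N).
split; rewrite /bq0 /bq1 /bq2 ?expr2.
- by apply: T => //; apply: topD => //; apply: topN.
- apply: topD; first by apply: T => //; [apply: N0; apply: topD|apply: topD].
  rewrite -!mulrA; apply: N0; apply: T0.
  by rewrite !mulrA -[V * V' * V * _]mulrA -[v * v' * v * _]mulrA; apply: T.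
apply: topD; first by apply: T => //; apply: topD => //; apply: topN.
apply: topN; apply: T => //; last exact: topD.
by rewrite -!(mulrA 4%:R); apply: N0.
Qed.
End TopForms.

Lemma proportional2 (K : fieldType) (u v x z : K) :
  (u != 0) || (v != 0) -> (x != 0) || (z != 0) -> u * z = v * x ->
  exists2 l : K, l != 0 & u = l * x /\ v = l * z.
Proof.
move=> n n' e; case: (eqVneq z 0) => [z0|nz].
  have nx : x != 0 by move: n'; rewrite z0 eqxx orbF.
  have v0 : v = 0 by apply: (mulIf nx); rewrite -e z0 mulr0 mul0r.
  move: n; rewrite v0 eqxx orbF => nu; exists (u / x); rewrite ?mulf_neq0 ?invr_eq0 //.
  by rewrite divfK // z0 mulr0.
have nv : v != 0.
  move: n; case: (eqVneq v 0) e => // ->; rewrite mul0r orbF => /eqP.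
  by rewrite mulf_eq0 (negbTE nz) orbF => /eqP ->; rewrite eqxx.
exists (v / z); rewrite ?mulf_neq0 ?invr_eq0 //.
by split; [rewrite mulrAC -e mulfK|rewrite divfK].
Qed.

(** * Degrees of maps on abscissae *)

Section Degree.
Variables (K : closedFieldType) (C : short_curve K).
Notation A := (sA C).
Notation B := (sB C).
Implicit Types (D U V : {poly K}) (f g : spoint C -> spoint C) (P Q : spoint C).

(* D vanishes at the finitely many abscissae where U / V is not required to represent f. *)
Definition xrep D f n U V :=
  [/\ (size U <= n.+1)%N, (size V <= n.+1)%N, (U`_n != 0) || (V`_n != 0), coprimep U V
    & forall P x y, val P = Some (x, y) -> D.[x] != 0 -> U.[x] * zc (f P) = V.[x] * xc (f P)].

Definition has_deg D f n := exists U V, xrep D f n U V.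

Lemma poly_eq0_generic D p : D != 0 -> (forall x, D.[x] != 0 -> p.[x] = 0) -> p = 0.
Proof.
move=> nD h; apply/eqP/negPn/negP => np.
have /closed_nonrootP[x] : p * D != 0 by rewrite mulf_neq0.
by rewrite rootE hornerM mulf_eq0 negb_or => /andP[/negP nx /h]; move/eqP.
Qed.

Lemma point_above x : exists P y, val P = Some (x, y).
Proof.
have /closed_rootP[y] : size ('X^2 - (x ^+ 3 + A * x + B)%:P) != 1.
  by rewrite size_XnsubC.
rewrite rootE !hornerE subr_eq0 => h.
by exists (@SPoint K C (Some (x, y)) h), y.
Qed.

Lemma coprimep_horner U V x : coprimep U V -> (U.[x] != 0) || (V.[x] != 0).
Proof.
move/Pdiv.ClosedField.coprimepP => h; case: (boolP (root U x)) => [/h ->|]; first exact: orbT.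
by rewrite rootE => ->.
Qed.

Lemma xrep_point D f n U V P x y : xrep D f n U V -> val P = Some (x, y) -> D.[x] != 0 ->
  exists2 l : K, l != 0 & U.[x] = l * xc (f P) /\ V.[x] = l * zc (f P).
Proof.
move=> [_ _ _ cp h] eP nD; apply: proportional2 (xz_neq0 _) (h _ _ _ eP nD).
exact: coprimep_horner.
Qed.

Lemma has_deg_weak D D' f n : (forall x, D'.[x] != 0 -> D.[x] != 0) ->
  has_deg D f n -> has_deg D' f n.
Proof.
move=> sD [U [V [h1 h2 h3 h4 h5]]]; exists U, V; split=> // P x y eP nD.
exact: h5 eP (sD _ nD).
Qed.

(** The degree only sees abscissae, hence maps up to a sign that may vary from point to point. *)
Lemma has_deg_eq D f g n : (forall P, f P = g P \/ f P = - g P) -> has_deg D f n -> has_deg D g n.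
Proof.
move=> e [U [V [h1 h2 h3 h4 h5]]]; exists U, V; split=> // P x y eP nD.
by have := h5 _ _ _ eP nD; case: (e P) => ->; rewrite ?xcN ?zcN.
Qed.

Lemma has_deg_id : has_deg 1 id 1.
Proof.
exists 'X, 1; split; rewrite ?size_polyX ?size_poly1 ?coefX ?oner_neq0 ?coprimep1 //.
by move=> P x y; rewrite /xc /zc => ->; rewrite !hornerE.
Qed.

Lemma has_deg_0 : has_deg 1 (fun _ => 0) 0.
Proof.
exists 1, 0; split; rewrite ?size_poly1 ?size_poly0 ?coef1 ?oner_neq0 ?coprime1p //.
by move=> P x y _ _; rewrite /xc /zc /= !hornerE.
Qed.

Lemma xrep_size D f n U V : xrep D f n U V -> maxn (size U) (size V) = n.+1.
Proof.
move=> [sU sV tU _ _]; apply/eqP; rewrite eqn_leq geq_max sU sV /= leq_max.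
case/orP: tU => h; [have -> : size U = n.+1|have -> : size V = n.+1]; rewrite ?leqnn ?orbT //.
  exact: top_size (conj sU (erefl _)) h.
exact: top_size (conj sV (erefl _)) h.
Qed.

(** The two fractions agree outside the zeros of [D * D'], so they are equal; being in lowest terms,
    they have associate numerators and denominators. *)
Lemma xrep_unique D D' f n m U V U' V' : D != 0 -> D' != 0 ->
  xrep D f n U V -> xrep D' f m U' V' -> n = m.
Proof.
move=> nD nD' r r'.
have e : U * V' = U' * V.
  apply/eqP; rewrite -subr_eq0; apply/eqP; apply: (@poly_eq0_generic (D * D')).
    by rewrite mulf_neq0.
  move=> x; rewrite hornerM mulf_eq0 negb_or => /andP[h h'].
  have [P [y eP]] := point_above x.
  have [l _ [e e']] := xrep_point r eP h.
  have [l' _ [e2 e2']] := xrep_point r' eP h'.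
  by rewrite !hornerE e e' e2 e2'; ring.
have [[sU sV tU cop _] [sU' sV' tU' cop' _]] := (r, r').
have eqU : U %= U'.
  apply/andP; split.
    by rewrite -(Gauss_dvdpl _ cop) -e dvdp_mulr.
  by rewrite -(Gauss_dvdpl _ cop') e dvdp_mulr.
have eqV : V %= V'.
  rewrite coprimep_sym in cop; rewrite coprimep_sym in cop'.
  apply/andP; split.
    by rewrite -(Gauss_dvdpr _ cop) e dvdp_mull.
  by rewrite -(Gauss_dvdpr _ cop') -e dvdp_mull.
have eU := eqp_size eqU; have eV := eqp_size eqV.
by apply: succn_inj; rewrite -(xrep_size r) -(xrep_size r') eU eV.
Qed.

Lemma has_deg_unique D D' f n m : D != 0 -> D' != 0 -> has_deg D f n -> has_deg D' f m -> n = m.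
Proof. by move=> nD nD' [U [V r]] [U' [V' r']]; apply: xrep_unique nD nD' r r'. Qed.

(** The parallelogram law. The forms in the abscissae of f and g are, pointwise up to a factor, the
    symmetric functions of the abscissae of f + g and f - g. Splitting off the known abscissa (c :
    d) of f - g leaves that of f + g, and counting degrees at infinity gives the equation. *)
Lemma has_deg_sum D f g n m k : D != 0 -> has_deg D f n -> has_deg D g m ->
  has_deg D (fun P => f P - g P) k ->
  exists2 s, has_deg D (fun P => f P + g P) s & (s + k = n + m + (n + m))%N.
Proof.
move=> nD [U [V r]] [U' [V' r']] [c [d rd]].
set w0 := bq0 U V U' V'; set w1 := bq1 A%:P B%:P U V U' V'; set w2 := bq2 A%:P B%:P U V U' V'.
have wE x : [/\ w0.[x] = bq0 U.[x] V.[x] U'.[x] V'.[x],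
    w1.[x] = bq1 A B U.[x] V.[x] U'.[x] V'.[x] & w2.[x] = bq2 A B U.[x] V.[x] U'.[x] V'.[x]].
  exact: horner_bq.
case: (r) (r') (rd) => sU sV tU _ _ [sU' sV' tU' _ _] [sc sd _ _ _].
have nn := erefl (n + m + (n + m))%N.
have [] := @top_bq K A B n m U V U' V' _ _ _ _ _
  (conj sU (erefl _)) (conj sV (erefl _)) (conj sU' (erefl _)) (conj sV' (erefl _)) nn.
rewrite -/w0 -/w1 -/w2 => t0 t1 t2.
clearbody w0 w1 w2.
have wP P x y : val P = Some (x, y) -> D.[x] != 0 -> exists2 l : K, l != 0 &
    [/\ w0.[x] = l * (zc (f P + g P) * zc (f P - g P)),
      w1.[x] = l * (xc (f P + g P) * zc (f P - g P) + xc (f P - g P) * zc (f P + g P))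
    & w2.[x] = l * (xc (f P + g P) * xc (f P - g P))].
  move=> eP nDx; have [l l0 [eU eV]] := xrep_point r eP nDx.
  have [l' l0' [eU' eV']] := xrep_point r' eP nDx.
  have [s s0 [h0 h1 h2]] := sum_diff (f P) (g P).
  exists ((l * l') ^+ 2 * s); first by rewrite mulf_neq0 // expf_neq0 // mulf_neq0.
  have [-> -> ->] := wE x; rewrite eU eV eU' eV' -!(mulrA _ s) -h0 -h1 -h2.
  by split; rewrite /bq0 /bq1 /bq2; ring.
have hQ : w0 * c ^+ 2 - w1 * c * d + w2 * d ^+ 2 = 0.
  apply: (poly_eq0_generic nD) => x nDx; have [P [y eP]] := point_above x.
  have [l _ [e0 e1 e2]] := wP _ _ _ eP nDx; have [l' _ [ec ed]] := xrep_point rd eP nDx.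
  by rewrite !hornerE /= e0 e1 e2 ec ed; ring.
case: (rd) => _ _ tcd cop _.
have /Bezout_eq1_coprimepP[[s t] /= bez] : coprimep (c ^+ 2) (d ^+ 2).
  by rewrite coprimep_expl // coprimep_expr.
(* (c, d) is a root of the binary quadratic form (w0, - w1, w2); the Bezout relation
   yields the complementary linear factor, i.e. the abscissa (a : b) of f + g. *)
pose b := s * (w1 * c - w2 * d) + t * (w0 * d).
pose a := s * (w2 * c) + t * (w1 * d - w0 * c).
have eb : w0 = b * d.
  transitivity (w0 * (s * c ^+ 2 + t * d ^+ 2)); first by rewrite bez mulr1.
  rewrite -[b * d]addr0 -(mulr0 s) -hQ /b. ring.
have ea : w2 = a * c.
  transitivity (w2 * (s * c ^+ 2 + t * d ^+ 2)); first by rewrite bez mulr1.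
  by rewrite -[a * c]addr0 -(mulr0 t) -hQ /a; ring.
have e1 : w1 = a * d + c * b.
  transitivity (w1 * (s * c ^+ 2 + t * d ^+ 2)); first by rewrite bez mulr1.
  by rewrite /a /b; ring.
clearbody a b.
(* A common root of a and b would be a common zero of the three forms, against [bq_neq0]. *)
have cab : coprimep a b.
  apply/Pdiv.ClosedField.coprimepP => x; rewrite rootE => /eqP a0; apply/eqP => b0.
  case: (r) (r') => _ _ _ cp _ [_ _ _ cp' _].
  have := bq_neq0 C (coprimep_horner x cp) (coprimep_horner x cp').
  have [<- <- <-] := wE x; rewrite eb e1 ea !hornerE a0 b0 !(mul0r, mulr0, addr0).
  by rewrite !eqxx.
have [N [sa sb tab]] : exists n, [/\ (size a <= n.+1)%N, (size b <= n.+1)%N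
    & (a`_n != 0) || (b`_n != 0)].
  apply: top_exists2; rewrite -negb_and; apply/negP => /andP[/eqP a0 /eqP b0].
  by move: cab; rewrite a0 b0 coprime0p => /eqp_size; rewrite size_poly0 size_poly1.
exists N.
  exists a, b; split=> // P x y eP nDx.
  have [l l0 [h0 h1 h2]] := wP _ _ _ eP nDx; have [l' l0' [ec ed]] := xrep_point rd eP nDx.
  move: h0 h1 h2; rewrite eb e1 ea !hornerE /= ec ed => h0 h1 h2.
  (* The products determine the factor belonging to f + g after division by a nonzero coordinate of
     [f P - g P]. *)
  have [E1 E2] : b.[x] * l' = l * zc (f P + g P) /\ a.[x] * l' = l * xc (f P + g P).
    case: (eqVneq (zc (f P - g P)) 0) => [z0|nz].
      have nx : xc (f P - g P) != 0 by have := xz_neq0 (f P - g P); rewrite z0 eqxx orbF.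
      move: h1; rewrite z0 !(mulr0, add0r) => h1.
      split; apply: (mulIf nx).
        by transitivity (l' * xc (f P - g P) * b.[x]); [|rewrite h1]; ring.
      by transitivity (a.[x] * (l' * xc (f P - g P))); [|rewrite -h2]; ring.
    have E1 : b.[x] * l' = l * zc (f P + g P).
      apply: (mulIf nz).
      by transitivity (b.[x] * (l' * zc (f P - g P))); [ring|rewrite h0; ring].
    split=> //; apply: (mulIf nz).
    apply: (addIr (xc (f P - g P) * (b.[x] * l'))).
    transitivity (a.[x] * (l' * zc (f P - g P)) + l' * xc (f P - g P) * b.[x]); first by ring.
    by rewrite h1 E1; ring.
  apply: (mulIf l0'); by rewrite mulrAC E2 [RHS]mulrAC E1; ring.
have tb : top N b b`_N by []. have ta : top N a a`_N by [].
have tc : top k c c`_k by []. have td : top k d d`_k by [].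
have t0' := topM tb td (erefl _); have t2' := topM ta tc (erefl _).
have t1' := topD (topM ta td (erefl _)) (topM tc tb (addnC _ _)).
rewrite -eb -ea -e1 in t0' t1' t2'.
(* The forms have formal degree N + k by the factorisation and 2(n + m) by [top_bq], in both cases
   with values at infinity that are not all 0. *)
apply: (top_unique3 t0' t1' t2' _ t0 t1 t2 (bq_neq0 C tU tU')).
rewrite -!negb_and; apply/negP => /and3P[].
move: tab tcd; rewrite !mulf_eq0.
case: (eqVneq b`_N 0) => [->|nb] /=; rewrite ?orbF ?mulr0 ?addr0.
  by move=> na; rewrite mulf_eq0 (negbTE na) /= => h _ /eqP dk ck; rewrite dk eqxx ck in h.
move=> _ h /eqP dk; rewrite dk mulr0 add0r mulf_eq0 (negbTE nb) orbF => ck.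
by rewrite dk eqxx ck in h.
Qed.

End Degree.

(** * Substitution of fractions into homogenised polynomials *)

Section TopSubst.
Variable K : fieldType.
Implicit Types p q U X Z : {poly K}.

Lemma top_exp m i p a : top m p a -> top (i * m) (p ^+ i) (a ^+ i).
Proof.
move=> hp; elim: i => [|i IH]; first exact: topC.
by rewrite !exprS mulSn; apply: topM hp IH (erefl _).
Qed.

Lemma top_sum n k (F : 'I_k -> {poly K}) (a : 'I_k -> K) :
  (forall i, top n (F i) (a i)) -> top n (\sum_i F i) (\sum_i a i).
Proof.
move=> h; apply: (big_rec2 (fun p c => top n p c)) => [|i c p _ hp]; last exact: topD.
by split; rewrite ?size_poly0 ?coef0.
Qed.

(** The form of degree n that dehomogenises to U, evaluated at scalars; [homp] evaluates it at
    polynomials. *)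
Definition hom U n (x z : K) := \sum_(i < n.+1) U`_i * (x ^+ i * z ^+ (n - i)).
Definition homp U n X Z := \sum_(i < n.+1) (U`_i)%:P * (X ^+ i * Z ^+ (n - i)).

Lemma horner_homp U n X Z t : (homp U n X Z).[t] = hom U n X.[t] Z.[t].
Proof.
rewrite /homp /hom horner_sum; apply: eq_bigr => i _.
by rewrite !hornerM hornerC !horner_exp.
Qed.

Lemma top_homp U n m X Z x z : top m X x -> top m Z z ->
  top (n * m) (homp U n X Z) (hom U n x z).
Proof.
move=> hx hz; apply: top_sum => i.
have t := topM (top_exp i hx) (top_exp (n - i) hz) (erefl _).
have le_in : (i <= n)%N by rewrite -ltnS.
rewrite -mulnDl subnKC // in t.
exact: topM (topC _) t (erefl _).
Qed.

Lemma hom_affine U n x z : (size U <= n.+1)%N -> hom U n (x * z) z = z ^+ n * U.[x].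
Proof.
move=> s; rewrite (horner_coef_wide _ s) mulr_sumr; apply: eq_bigr => i _.
have le_in : (i <= n)%N by rewrite -ltnS.
have -> : z ^+ n = z ^+ i * z ^+ (n - i) by rewrite -exprD subnKC.
by rewrite exprMn; ring.
Qed.

Lemma hom_infty U n x : hom U n x 0 = U`_n * x ^+ n.
Proof.
rewrite /hom big_ord_recr /= subnn mulr1 big1 ?add0r // => i _.
by rewrite expr0n subn_eq0 leqNgt ltn_ord !mulr0.
Qed.
End TopSubst.

(** * Degrees of multiplications, composites and twisted sums *)

Section Degree.
Variables (K : closedFieldType) (C : short_curve K).
Notation A := (sA C).
Notation B := (sB C).
Implicit Types (D U V : {poly K}) (f g : spoint C -> spoint C) (P Q : spoint C).

Lemma hom_neq0 U V n x z : (size U <= n.+1)%N -> (size V <= n.+1)%N ->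
  (U`_n != 0) || (V`_n != 0) -> coprimep U V -> (x != 0) || (z != 0) ->
  (hom U n x z != 0) || (hom V n x z != 0).
Proof.
move=> sU sV tU cop nxz; case: (eqVneq z 0) => [z0|nz]; last first.
  by rewrite -(divfK nz x) !hom_affine // !mulf_eq0 expf_eq0 (negbTE nz) andbF coprimep_horner.
move: nxz; rewrite z0 eqxx orbF => nx.
by rewrite !hom_infty !mulf_eq0 expf_eq0 (negbTE nx) andbF !orbF.
Qed.

(** The parallelogram law for [n+1] and the identity, whose difference is [n], gives deg [n+2] =
    2(n+1)^2 + 2 - n^2. The induction therefore carries two consecutive values. *)
Lemma has_deg_muln n : has_deg 1 (fun P => P *+ n) (n ^ 2).
Proof.
suff [] : has_deg 1 (fun P => P *+ n) (n ^ 2) /\ has_deg 1 (fun P => P *+ n.+1) (n.+1 ^ 2) by [].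
elim: n => [|n [IH1 IH2]].
  by split; [exact: has_deg_0|exact: has_deg_id].
split=> //; have IH1' : has_deg 1 (fun P => P *+ n.+1 - P) (n ^ 2).
  by apply: has_deg_eq IH1 => P; left; rewrite mulrSr addrK.
have [s h es] := has_deg_sum (oner_neq0 _) IH2 (has_deg_id C) IH1'.
have -> : (n.+2 ^ 2)%N = s by move: es; rewrite !expnS !expn0; lia.
by apply: has_deg_eq h => P; left; rewrite -mulrSr.
Qed.

Lemma top_neq0_size_gt1 n U V : (U`_n != 0) || (V`_n != 0) -> (0 < n)%N ->
  ~~ ((size U <= 1) && (size V <= 1))%N.
Proof.
move=> t n0; apply/negP => /andP[sU sV]; move: t.
by rewrite !nth_default ?eqxx //; apply: leq_trans n0.
Qed.

Lemma has_deg_comp D D' f g n m : D != 0 -> D' != 0 -> (0 < m)%N ->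
  has_deg D f n -> has_deg D' g m ->
  exists2 D'', D'' != 0 & has_deg D'' (fun P => f (g P)) (n * m).
Proof.
move=> nD nD' m0 [U [V r]] [U' [V' r']].
have [r0 eD] := closed_field_poly_normal D.
case: (r) (r') => sU sV tU cop hr [sU' sV' tU' cop' _].
have gt1 := top_neq0_size_gt1 tU' m0.
have nV' : V' != 0.
  apply: contra gt1 => /eqP e; move: cop'; rewrite e coprimep0 => /eqp_size ->.
  by rewrite size_poly1 size_poly0.
(* Positivity of m makes the fraction U'/V' nonconstant. *)
have nE z : U' - z%:P * V' != 0.
  apply: contra gt1; rewrite subr_eq0 => /eqP e.
  have : coprimep V' V' by apply: coprimep_dvdr cop'; rewrite e dvdp_mull.
  rewrite coprimepp => /eqP s1; rewrite s1 e leqnn andbT.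
  by apply: leq_trans (size_polyMleq _ _) _; rewrite s1 addn1 size_polyC_leq1.
(* Excluded are the abscissae excluded for g, those where g P is at infinity, and those where the
   abscissa of g P is a root z of D. *)
exists (D' * V' * \prod_(z <- r0) (U' - z%:P * V')).
  by rewrite !mulf_neq0 // prodf_seq_neq0; apply/allP => z _; apply/implyP.
exists (homp U n U' V'), (homp V n U' V').
have tU2 : top m U' U'`_m by []. have tV2 : top m V' V'`_m by [].
have [s1 e1] := top_homp U n tU2 tV2. have [s2 e2] := top_homp V n tU2 tV2.
split=> //; first by rewrite e1 e2 hom_neq0.
  apply/Pdiv.ClosedField.coprimepP => x; rewrite rootE !horner_homp => /eqP a0.
  have := hom_neq0 sU sV tU cop (coprimep_horner x cop').
  by rewrite a0 eqxx.
move=> P x y eP; rewrite !hornerM !mulf_eq0 !negb_or -andbA => /and3P[h1 h2 h3].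
have [l l0 [eU eV]] := xrep_point r' eP h1.
rewrite !horner_homp; case eg : (val (g P)) => [[x' y']|]; last first.
  by move: h2; rewrite eV /zc eg mulr0 eqxx.
have eU' : U'.[x] = x' * l by rewrite eU /xc eg mulrC.
have eV' : V'.[x] = l by rewrite eV /zc eg mulr1.
rewrite eU' eV' !hom_affine // -!mulrA; congr (_ * _); apply: hr eg _.
move: h3; rewrite eD hornerZ mulf_eq0 negb_or lead_coef_eq0 nD /= horner_prod.
rewrite horner_prod => h3; rewrite prodf_seq_neq0; apply/allP => z zr /=.
move: h3; rewrite prodf_seq_neq0 => /allP/(_ z zr) /=.
by rewrite !hornerE /= eU' eV' -mulrBl mulf_eq0 (negbTE l0) orbF.
Qed.

(** Cancelling the gcd of a and b yields a reduced fraction of unknown degree; degree 0 is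
    recognised by a and b being proportional. *)
Lemma has_deg_rational D f a b : (a != 0) || (b != 0) ->
  (forall P x y, val P = Some (x, y) -> D.[x] != 0 ->
     ((a.[x] != 0) || (b.[x] != 0)) /\ a.[x] * zc (f P) = b.[x] * xc (f P)) ->
  exists2 n, has_deg D f n &
    n = 0%N -> exists u v, (u != 0) || (v != 0) /\ v *: a = u *: b.
Proof.
move=> nab h; pose g := gcdp a b; pose U := a %/ g; pose V := b %/ g.
have ea : a = U * g by rewrite divpK // dvdp_gcdl.
have eb : b = V * g by rewrite divpK // dvdp_gcdr.
have cop : coprimep U V by apply: coprimep_div_gcd.
have nUV : (U != 0) || (V != 0).
  rewrite -negb_and; apply: contraL nab => /andP[/eqP U0 /eqP V0].
  by rewrite ea eb U0 V0 mul0r eqxx.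
have [n [sU sV t]] := top_exists2 nUV; exists n.
  exists U, V; split=> // P x y eP nD; have [nx e] := h _ _ _ eP nD.
  have ng : g.[x] != 0.
    by apply: contraTneq nx => g0; rewrite ea eb !hornerM g0 !mulr0 eqxx.
  by apply: (mulIf ng); move: e; rewrite {1}ea {1}eb !hornerM => e; rewrite mulrAC e mulrAC.
move=> n0; exists U`_0, V`_0; rewrite n0 in sU sV t; split=> //.
rewrite {1}ea {1}eb (size1_polyC sU) (size1_polyC sV) !coefC /= -!mul_polyC; ring.
Qed.

(* Numerator, over (c X^(2r+1) - X)^2, of the abscissa of (x, y) + (c x^(2r+1), d y^(2r+1)),
   using y^(2r+1) = y (x^3 + A x + B)^r. *)
Definition twist_num c d r : {poly K} :=
  ('X^3 + A%:P * 'X + B%:P) * (d%:P * ('X^3 + A%:P * 'X + B%:P) ^+ r - 1) ^+ 2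
  - ('X + c%:P * 'X^(r.*2.+1)) * (c%:P * 'X^(r.*2.+1) - 'X) ^+ 2.

(** Serves both the scalings, with r = 0, and Frobenius, with c = d = 1. The excluded abscissae are
    those where P and f P have the same abscissa. *)
Lemma has_deg_add_twist f c d r :
  (forall P x y, val P = Some (x, y) ->
     val (f P) = Some (c * x ^+ r.*2.+1, d * y ^+ r.*2.+1)) ->
  c%:P * 'X^(r.*2.+1) - 'X != 0 :> {poly K} ->
  exists2 n, has_deg (c%:P * 'X^(r.*2.+1) - 'X) (fun P => P + f P) n &
    n = 0%N -> exists u v, (u != 0) || (v != 0) /\
      v *: twist_num c d r = u *: (c%:P * 'X^(r.*2.+1) - 'X) ^+ 2.
Proof.
move=> hf nD; apply: has_deg_rational; first by rewrite expf_neq0 ?orbT.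
move=> P x y eP; rewrite horner_exp => nx; rewrite expf_neq0 // orbT; split=> //.
rewrite !hornerE /= in nx *; have := hf _ _ _ eP; case: P eP => w c1 /= ew; subst w.
case: (f _) => w c2 /= ew; subst w.
have nxx : x != c * x ^+ r.*2.+1 by apply: contra nx => /eqP <-; rewrite subrr.
have eS : val (SPoint c1 + SPoint c2) = _ := sadd_sline C y (d * y ^+ r.*2.+1) nxx.
rewrite /xc /zc eS /sline.
have ey : y ^+ r.*2.+1 = y * (x ^+ 3 + A * x + B) ^+ r.
  by rewrite exprS -mul2n exprM; congr (_ * _ ^+ _); apply/eqP.
have ef : x ^+ 3 + A * x + B = y ^+ 2 by apply/esym/eqP.
rewrite ey ef mulr1; set z := c * _ in nx *; set w := (y ^+ 2) ^+ r.
by field.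
Qed.

Lemma cubic_poly_eq0 (a b c d : K) :
  a%:P * 'X^3 + b%:P * 'X^2 + c%:P * 'X + d%:P = 0 -> [/\ a = 0, b = 0, c = 0 & d = 0].
Proof.
move=> e; have h i := congr1 (fun p : {poly K} => p`_i) e.
have := (h 3, h 2, h 1, h 0); rewrite /= !(coefD, coefCM, coefXn, coefX, coefC, coef0) /=.
by rewrite !(mulr0, mulr1, addr0, add0r) => -[[[-> ->] ->] ->].
Qed.

(** In degree 0 the numerator, of degree at most 3, and the denominator (v^2 - 1)^2 X^2 would be
    proportional. Comparing coefficients gives first v^3 = 1, as A and B are not both 0, then v^2 =
    -1; hence v = -1 and v^2 = 1, which is excluded. *)
Lemma has_deg_add_unit v f : v ^+ 2 != 1 ->
  (forall P x y, val P = Some (x, y) -> val (f P) = Some (v ^+ 2 * x, v ^+ 3 * y)) ->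
  exists2 n, (0 < n)%N & has_deg (((v ^+ 2)%:P - 1) * 'X) (fun P => P + f P) n.
Proof.
move=> nv hf; pose c := v ^+ 2; pose d := v ^+ 3.
have eD : (v ^+ 2)%:P * 'X^(0.*2.+1) - 'X = ((v ^+ 2)%:P - 1) * 'X :> {poly K}.
  by rewrite mulrBl mul1r.
have c1 : v ^+ 2 - 1 != 0 by rewrite subr_eq0.
have nD : ((v ^+ 2)%:P - 1) * 'X != 0 :> {poly K}.
  by rewrite mulf_neq0 ?polyX_eq0 // -polyC1 -polyCB polyC_eq0.
have [|n h n0] := @has_deg_add_twist f (v ^+ 2) (v ^+ 3) 0 hf; rewrite ?eD //.
exists n; last by rewrite -eD.
rewrite lt0n; apply/negP => /eqP/n0[s [t [nst]]]; rewrite eD /twist_num eD.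
move=> /eqP; rewrite -subr_eq0 => /eqP e.
have [] := @cubic_poly_eq0 (t * ((v ^+ 3 - 1) ^+ 2 - (1 + v ^+ 2) * (v ^+ 2 - 1) ^+ 2))
  (- (s * (v ^+ 2 - 1) ^+ 2)) (t * (A * (v ^+ 3 - 1) ^+ 2)) (t * (B * (v ^+ 3 - 1) ^+ 2)).
  rewrite -[RHS]e -!mul_polyC !(rmorphM, rmorphB, rmorphD, rmorphN, rmorphXn, rmorph1) /=.
  by ring.
move=> e3 /eqP; rewrite oppr_eq0 mulf_eq0 expf_eq0 (negbTE c1) orbF => /eqP s0.
move: nst; rewrite s0 eqxx /= => t0 e1 e0.
have d1 : v ^+ 3 = 1.
  apply/eqP; rewrite -subr_eq0; apply/negPn/negP => nd.
  have nd2 : (v ^+ 3 - 1) ^+ 2 != 0 by rewrite expf_neq0.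
  move: e1 e0 => /eqP; rewrite mulf_eq0 (negbTE t0) mulf_eq0 (negbTE nd2) orbF => /eqP A0.
  move=> /eqP; rewrite mulf_eq0 (negbTE t0) mulf_eq0 (negbTE nd2) orbF => /eqP B0.
  by have := short_disc C; rewrite A0 B0 !expr0n !mulr0 addr0 eqxx.
move: e3 => /eqP; rewrite d1 subrr expr0n /= sub0r mulrN oppr_eq0 mulf_eq0 (negbTE t0) /=.
rewrite mulf_eq0 sqrf_eq0 (negbTE c1) orbF => /eqP v2.
have ev : v ^+ 2 = -1 by apply/eqP; rewrite -addr_eq0 addrC v2.
have v1 : v = -1 by apply: oppr_inj; rewrite opprK -d1 exprS ev mulrN1.
by move: nv; rewrite v1 sqrrN expr1n eqxx.
Qed.

End Degree.

(** * Frobenius whose square is a scaled multiplication *)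

(** The p-adic valuation of a square is even, while that of the right-hand side is e, since 4 and d
    are smaller than p. *)
Lemma odd_pow_square_mul_small p e d a : prime p -> (3 < p)%N -> odd e -> (0 < d <= 4)%N ->
  (a ^ 2 <> 4 * d * p ^ e)%N.
Proof.
move=> pp p3 oe /andP[d0 d4] eq; have p0 := prime_gt0 pp.
have l0 m : (0 < m < p)%N -> logn p m = 0%N.
  by move=> /andP[m0 mp]; rewrite lognE pp m0 gtnNdvd.
have p4 : (4 < p)%N by rewrite ltn_neqAle p3 andbT; apply: contraTneq pp => <-.
have := congr1 (logn p) eq; rewrite lognX !lognM ?muln_gt0 ?d0 ?expn_gt0 ?p0 //.
rewrite pfactorK // (l0 4) // (l0 d) ?d0 ?(leq_ltn_trans d4) // => ee.
by move: oe; rewrite -[e]/(0 + 0 + e)%N -ee mul2n odd_double.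
Qed.

Section Twist.
Variables (K : closedFieldType) (C : short_curve K).
Implicit Types (P Q : spoint C).

Lemma has_deg_weak1 D (f : spoint C -> spoint C) n : has_deg 1 f n -> has_deg D f n.
Proof. by apply: has_deg_weak => x _; rewrite hornerC oner_neq0. Qed.

Lemma has_deg_monomial (f : spoint C -> spoint C) c n : c != 0 -> (0 < n)%N ->
  (forall P x y, val P = Some (x, y) -> exists y', val (f P) = Some (c * x ^+ n, y')) ->
  has_deg 1 f n.
Proof.
move=> c0 n0 h; exists (c *: 'X^n), 1; split.
- by rewrite size_scale // size_polyXn.
- by rewrite size_poly1.
- by rewrite coefZ coefXn eqxx mulr1 c0.
- exact: coprimep1.
move=> P x y eP _; have [y' e] := h _ _ _ eP.
by rewrite /xc /zc e hornerZ hornerXn hornerC mulr1 mul1r.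
Qed.

Variables (v : K) (sigma : spoint C -> spoint C).
Hypotheses (v0 : v != 0) (v2 : v ^+ 2 != 1).
Hypothesis sigmaE : forall P x y, val P = Some (x, y) ->
  val (sigma P) = Some (v ^+ 2 * x, v ^+ 3 * y).

(** Here d = deg(1 - sigma). The parallelogram law gives deg(1 + sigma) + d = 4, which bounds d, and
    a recurrence in n for deg(1 + n sigma) solved by (n+1)^2 - dn. Since -sigma is the scaling by
    -v, [has_deg_add_unit] makes both degrees positive. *)
Lemma has_deg_add_unit_muln : exists D d, [/\ D != 0, (0 < d <= 4)%N &
  forall n, exists2 m, has_deg D (fun P => P + sigma P *+ n) m & (m + d * n = n.+1 ^ 2)%N].
Proof.
have [d1 p1 h1] := has_deg_add_unit v2 sigmaE.
have nv2 : (- v) ^+ 2 != 1 by rewrite sqrrN.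
have sigmaNE P x y : val P = Some (x, y) ->
    val (- sigma P) = Some ((- v) ^+ 2 * x, (- v) ^+ 3 * y).
  move=> /sigmaE e; have -> : val (- sigma P) = sopp_raw (val (sigma P)) by [].
  by rewrite e /= sqrrN exprSr [(- v) ^+ 3]exprS sqrrN; congr (Some (_, _)); ring.
have [d2 p2 h2] := has_deg_add_unit nv2 sigmaNE; rewrite sqrrN in h2.
set D := (_ * 'X) in h1 h2; have nD : D != 0.
  by rewrite mulf_neq0 ?polyX_eq0 // -polyC1 -polyCB polyC_eq0 subr_eq0.
have hid : has_deg D id 1 := has_deg_weak1 D (has_deg_id C).
have hs : has_deg D sigma 1.
  apply/has_deg_weak1/(@has_deg_monomial _ (v ^+ 2)); rewrite ?expf_neq0 //.
  by move=> P x y /sigmaE ->; exists (v ^+ 3 * y).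
have [s h es] := has_deg_sum nD hid hs h2.
have e1 : s = d1 := has_deg_unique nD nD h h1.
exists D, d2; split=> //; first by rewrite p2 /=; move: es; lia.
suff H n : (exists2 m, has_deg D (fun P => P + sigma P *+ n) m & (m + d2 * n = n.+1 ^ 2)%N) /\
  (exists2 m, has_deg D (fun P => P + sigma P *+ n.+1) m & (m + d2 * n.+1 = n.+2 ^ 2)%N).
  by move=> n; case: (H n).
elim: n => [|n [[m hm em] [m' hm' em']]].
  split.
    by exists 1%N; [apply: has_deg_eq hid => P; left; rewrite addr0|rewrite muln0].
  by exists d1 => //; rewrite muln1 expnS expn1; move: es; lia.
split; first by exists m'.
have hm2 : has_deg D (fun P => P + sigma P *+ n.+1 - sigma P) m.
  by apply: has_deg_eq hm => P; left; rewrite mulrSr addrA addrK.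
have [k hk ek] := has_deg_sum nD hm' hs hm2.
exists k; first by apply: has_deg_eq hk => P; left; rewrite [in RHS]mulrSr addrA.
move: em em' ek; rewrite !expnS !expn0; nia.
Qed.

Variables (p e : nat) (frobq : spoint C -> spoint C).
Hypotheses (pp : prime p) (p3 : (3 < p)%N) (oe : odd e).
Hypothesis frobE : forall P x y, val P = Some (x, y) ->
  val (frobq P) = Some (x ^+ (p ^ e), y ^+ (p ^ e)).
Hypothesis frobD : {morph frobq : P Q / P + Q}.

(** With [dp] and [dm] the degrees of 1 + pi and 1 - pi, the parallelogram law gives dp + dm =
    2(q+1), and (1 + pi)(1 - pi) = 1 + q sigma gives dp dm = (q+1)^2 - dq. Hence (dp - dm)^2 =
    4dq. *)
Lemma frobenius_twist_contra :
  ~ (forall P, frobq (frobq P) = - (sigma P *+ (p ^ e))).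
Proof.
move=> rel; pose q := (p ^ e)%N; rewrite -/q in rel.
have frobE' P x y : val P = Some (x, y) -> val (frobq P) = Some (x ^+ q, y ^+ q) := @frobE P x y.
have q1 : (1 < q)%N.
  by apply: leq_trans (ltnW (ltnW p3)) _; rewrite -{1}[p]expn1 leq_exp2l ?(ltnW (ltnW p3)) ?odd_gt0.
have oq : q = (q./2).*2.+1.
  rewrite -[LHS]odd_double_half oddX; suff -> : odd p by rewrite orbT.
  by case: (even_prime pp) p3 => // ->.
have f0 : frobq 0 = 0 by apply: (addIr (frobq 0)); rewrite -frobD !add0r.
have fN P : frobq (- P) = - frobq P.
  by apply: (addIr (frobq P)); rewrite -frobD !addNr.
pose D : {poly K} := 1%:P * 'X^q - 'X.
have nD : D != 0.
  rewrite /D mul1r -lead_coef_eq0 lead_coefDl ?lead_coefXn ?oner_neq0 //.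
  by rewrite size_polyN size_polyX size_polyXn.
have [dp hp] : exists dp, has_deg D (fun P => P + frobq P) dp.
  have h P x y : val P = Some (x, y) ->
      val (frobq P) = Some (1 * x ^+ (q./2).*2.+1, 1 * y ^+ (q./2).*2.+1).
    by rewrite -oq !mul1r; apply: frobE'.
  have [|dp hp _] := has_deg_add_twist h; first by rewrite -oq.
  by exists dp; rewrite -oq in hp.
have hid : has_deg D id 1 := has_deg_weak1 D (has_deg_id C).
have hf : has_deg D (fun P => - frobq P) q.
  apply/has_deg_weak1/(@has_deg_monomial _ 1); rewrite ?oner_neq0 ?(ltnW q1) //.
  move=> P x y /frobE' ef; exists (- y ^+ q).
  have -> : val (- frobq P) = sopp_raw (val (frobq P)) by [].
  by rewrite ef mul1r.
have hp' : has_deg D (fun P => P - - frobq P) dp.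
  by apply: has_deg_eq hp => P; left; rewrite opprK.
have [dm hm es] := has_deg_sum nD hid hf hp'.
have [D' [d [nD' dr hn]]] := has_deg_add_unit_muln.
have [m hq eq] := hn q.
have emul : m = (dm * dp)%N.
  (* [has_deg_comp] requires an inner map of positive degree. The two factors commute and their
     degrees have a positive sum, so one of them can be placed inside. *)
  case: (posnP dp) => [dp0|dp0].
    have dm0 : (0 < dm)%N by move: es; rewrite dp0; lia.
    have [D'' nD'' hc] := has_deg_comp nD nD dm0 hp hm.
    rewrite mulnC; apply: (has_deg_unique nD' nD'' hq); apply: has_deg_eq hc => P; left.
    by rewrite frobD fN rel opprK addrA subrK.
  have [D'' nD'' hc] := has_deg_comp nD nD dp0 hm hp.
  apply: (has_deg_unique nD' nD'' hq); apply: has_deg_eq hc => P; left.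
  by rewrite frobD rel opprD opprK addrA addrK.
(* With truncated subtraction this sum is the absolute difference of [dp] and [dm]. *)
apply: (odd_pow_square_mul_small (a := (dp - dm) + (dm - dp)) pp p3 oe dr).
rewrite -/q; move: eq es; rewrite emul; clear; rewrite !expnS !expn0 !muln1.
by case: (leqP dp dm) => ? ? ?; nia.
Qed.
End Twist.

(** * Multiplication by p on supersingular curves *)

Lemma poly_only_root0 (K : closedFieldType) (g : {poly K}) n : size g = n.+1 ->
  (forall x, root g x -> x = 0) -> g = lead_coef g *: 'X^n.
Proof.
move=> sg h; have [r e] := closed_field_poly_normal g.
have lc : lead_coef g != 0 by rewrite lead_coef_eq0 -size_poly_eq0 sg.
have r0 z : z \in r -> z = 0.
  by move=> zr; apply: h; rewrite e rootZ // root_prod_XsubC.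
have ep : \prod_(z <- r) ('X - z%:P) = 'X^(size r) :> {poly K}.
  elim: r r0 {e} => [|z r IH] r0; first by rewrite big_nil.
  rewrite big_cons IH => [|w wr]; last by apply: r0; rewrite in_cons wr orbT.
  have -> : z = 0 by apply: r0; exact: mem_head.
  by rewrite subr0 -exprS.
have sr : size r = n by move: sg; rewrite e ep size_scale // size_polyXn => -[].
by rewrite {1}e ep sr.
Qed.

Lemma cubic_roots (K : closedFieldType) (A B : K) : exists e1 e2 e3 : K,
  [/\ e1 + e2 + e3 = 0, A = e1 * e2 + e1 * e3 + e2 * e3, B = - (e1 * e2 * e3)
    & forall i, i \in [:: e1; e2; e3] -> i ^+ 3 + A * i + B = 0].
Proof.
pose f : {poly K} := 'X^3 + A%:P * 'X + B%:P.
have sAB : (size (A%:P * 'X + B%:P)%R < 4)%N.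
  rewrite size_MXaddC; case: ifP => // _.
  by rewrite ltnS (leq_ltn_trans (size_polyC_leq1 _)).
have sf : size f = 4%N by rewrite /f -addrA size_polyDl size_polyXn.
have lf : lead_coef f = 1 by rewrite /f -addrA lead_coefDl ?lead_coefXn // size_polyXn.
have [r e] := closed_field_poly_normal f; rewrite lf scale1r in e.
have sr : size r = 3%N by move: sf; rewrite e size_prod_XsubC => -[].
case: r sr e => [|e1 [|e2 [|e3 [|]]]] // _ e; exists e1, e2, e3.
have hr i : i \in [:: e1; e2; e3] -> i ^+ 3 + A * i + B = 0.
  rewrite -root_prod_XsubC -e => /eqP; rewrite /f !hornerE /= => <-.
  by rewrite !exprS expr0; ring.
move: e; rewrite 3!big_cons big_nil mulr1 /f => /eqP; rewrite -subr_eq0 => /eqP e.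
have [] := @cubic_poly_eq0 K 0 (e1 + e2 + e3) (A - (e1 * e2 + e1 * e3 + e2 * e3)) (B + e1 * e2 * e3).
  rewrite -[RHS]e !(rmorphD, rmorphB, rmorphM) rmorph0 /=; ring.
move=> _ h1 /eqP; rewrite subr_eq0 => /eqP h2 /eqP; rewrite addr_eq0 => /eqP h3.
by split.
Qed.

Section Supersingular.
Variables (K : closedFieldType) (C : short_curve K) (p : nat).
Notation A := (sA C).
Notation B := (sB C).
Implicit Types (P Q : spoint C).
Hypotheses (chp : p \in [pchar K]) (p3 : (3 < p)%N).

Lemma exprD_pchar n (x y : K) : (x + y) ^+ (p ^ n) = x ^+ (p ^ n) + y ^+ (p ^ n).
Proof. by apply: exprDn_pchar; rewrite pnatX pnatE ?(pcharf_prime chp) // chp. Qed.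

Lemma odd_pchar : odd p.
Proof. by case: (even_prime (pcharf_prime chp)) p3 => // ->. Qed.

Lemma exprN_pchar n (x : K) : (- x) ^+ (p ^ n) = - x ^+ (p ^ n).
Proof. by rewrite exprNn -signr_odd oddX odd_pchar orbT expr1 mulN1r. Qed.

Lemma same_xc P Q x y y' : val P = Some (x, y) -> val Q = Some (x, y') -> P = Q \/ P = - Q.
Proof.
case: P Q => [w c] [w' c'] /= e e'; subst w w'.
by case: (same_abscissa c c') => ey; [left|right]; apply: val_inj; rewrite /= ey.
Qed.

Hypothesis ss : forall P, P *+ p = 0 -> P = 0.

(** The abscissa of [p] is a polynomial f of degree p^2, injective because [p] is, so f - f(0) has 0
    as its only root and is a monomial. The relations for A and B come from the points of order
    2. *)
Lemma supersingular_mulp : exists c,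
  [/\ c ^+ 2 * A ^+ (p ^ 2) = A, c ^+ 3 * B ^+ (p ^ 2) = B &
    forall P x y, val P = Some (x, y) -> exists y', val (P *+ p) = Some (c * x ^+ (p ^ 2), y')].
Proof.
have p0 : (0 < p)%N by apply: ltnW (ltnW (ltnW p3)).
have [U [V r]] := has_deg_muln C p.
have D1 x : (1 : {poly K}).[x] != 0 by rewrite hornerC oner_neq0.
have nz P x y : val P = Some (x, y) -> exists x' y', val (P *+ p) = Some (x', y').
  move=> eP; case e : (val (P *+ p)) => [[x' y']|]; first by exists x', y'.
  have /ss P0 : P *+ p = 0 by apply: val_inj.
  by rewrite P0 in eP.
(* A root of V would be the abscissa of an affine point sent to infinity by [p]. *)
have sV : size V = 1%N.
  apply/eqP/negPn/negP => /closed_rootP[x]; rewrite rootE => /eqP V0.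
  have [P [y eP]] := point_above C x; have [x' [y' e]] := nz _ _ _ eP.
  have [l l0 [_]] := xrep_point r eP (D1 x).
  by rewrite V0 /zc e mulr1 => /esym/eqP; rewrite (negbTE l0).
pose v := V`_0; have eV : V = v%:P by apply: size1_polyC; rewrite sV.
have v0 : v != 0 by rewrite -polyC_eq0 -eV -size_poly_eq0 sV.
pose f := v^-1 *: U.
have fE P x y : val P = Some (x, y) -> exists y', val (P *+ p) = Some (f.[x], y').
  move=> eP; have [x' [y' e]] := nz _ _ _ eP; exists y'; rewrite e; congr (Some (_, _)).
  case: r => _ _ _ _ /(_ _ _ _ eP (D1 x)); rewrite /zc /xc e eV hornerC mulr1.
  by rewrite hornerZ => ->; rewrite mulKf.
have sf : size f = (p ^ 2).+1.
  rewrite size_scale ?invr_eq0 //; case: r => sU _ tU _ _.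
  apply: (@top_size _ _ _ U`_(p ^ 2)); first by [].
  move: tU; rewrite eV coefC expn_eq0 andbT -[p == 0%N]negbK -lt0n p0 eqxx orbF //.
have inj x x' : f.[x] = f.[x'] -> x = x'.
  move=> e; have [P [y eP]] := point_above C x; have [P' [y' eP']] := point_above C x'.
  have [z ez] := fE _ _ _ eP; have [z' ez'] := fE _ _ _ eP'; rewrite e in ez.
  have [e'|e'] : P = P' \/ P = - P'.
    case: (same_xc ez ez') => /eqP h; [left|right]; apply/eqP.
      by rewrite -subr_eq0; apply/eqP/ss; rewrite mulrnBl; apply/eqP; rewrite subr_eq0.
    by rewrite -addr_eq0; apply/eqP/ss; rewrite mulrnDl; apply/eqP; rewrite addr_eq0.
  - by move: eP; rewrite e' eP' => -[].
  - move: eP; rewrite e' [val _]/(sopp_raw (val P')) eP' => -[] //.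
pose a := f.[0]; pose c := lead_coef (f - a%:P).
have ef : f = c *: 'X^(p ^ 2) + a%:P.
  rewrite -(@poly_only_root0 _ (f - a%:P) (p ^ 2)) ?subrK //.
    rewrite size_polyDl // size_polyN sf; apply: leq_ltn_trans (size_polyC_leq1 _) _.
    by rewrite ltnS expn_gt0 p0.
  by move=> x; rewrite rootE hornerD hornerN hornerC subr_eq0 => /eqP e; apply: inj; exact: e.
have fX x : f.[x] = c * x ^+ (p ^ 2) + a by rewrite ef hornerD hornerZ hornerXn hornerC.
have [e1 [e2 [e3 [s1 s2 s3 he]]]] := cubic_roots A B.
(* As p is odd, [p] fixes each point of order 2. *)
have fixe i : i \in [:: e1; e2; e3] -> i = c * i ^+ (p ^ 2) + a.
  move=> /he hi; have ci : on_short C (Some (i, 0)) by rewrite /= hi expr0n.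
  have d2 : SPoint ci *+ 2 = 0 by apply: val_inj; rewrite /= oppr0 !eqxx.
  have eP : SPoint ci *+ p = SPoint ci.
    by rewrite -[p]odd_double_half odd_pchar mulrnDr mulr1n -mul2n mulrnA d2 mul0rn addr0.
  by have [y'] := fE (SPoint ci) _ _ (erefl _); rewrite eP fX => -[].
have [z1 ez1] : exists z, z = e1 ^+ (p ^ 2) by exists (e1 ^+ (p ^ 2)).
have [z2 ez2] : exists z, z = e2 ^+ (p ^ 2) by exists (e2 ^+ (p ^ 2)).
have [z3 ez3] : exists z, z = e3 ^+ (p ^ 2) by exists (e3 ^+ (p ^ 2)).
have [h1 h2 h3] : [/\ e1 = c * z1 + a, e2 = c * z2 + a & e3 = c * z3 + a].
  by rewrite ez1 ez2 ez3; split; apply: fixe; rewrite !inE eqxx ?orbT.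
(* The roots and their p^2-th powers both sum to 0, so adding the three equations leaves 3a = 0. *)
have a0 : a = 0.
  have sz : z1 + z2 + z3 = 0.
    by rewrite ez1 ez2 ez3 -!exprD_pchar s1 expr0n expn_eq0 andbT eqn0Ngt p0.
  have /eqP : 3%:R * a = 0.
    by rewrite -[RHS]s1 h1 h2 h3 -[LHS]addr0 -(mulr0 c) -sz; ring.
  by rewrite mulf_eq0 -(dvdn_pcharf chp) gtnNdvd //= => /eqP.
rewrite a0 !addr0 in h1 h2 h3; exists c; split.
- have -> : A ^+ (p ^ 2) = z1 * z2 + z1 * z3 + z2 * z3.
    by rewrite s2 !exprD_pchar !exprMn ez1 ez2 ez3.
  by rewrite s2 h1 h2 h3; ring.
- have -> : B ^+ (p ^ 2) = - (z1 * z2 * z3).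
    by rewrite s3 exprN_pchar !exprMn ez1 ez2 ez3.
  by rewrite s3 h1 h2 h3; ring.
by move=> P x y /fE; rewrite fX a0 addr0.
Qed.

Lemma supersingular_mulp_iter k : exists c,
  [/\ c ^+ 2 * A ^+ (p ^ k.*2) = A, c ^+ 3 * B ^+ (p ^ k.*2) = B &
    forall P x y, val P = Some (x, y) ->
      exists y', val (P *+ (p ^ k)) = Some (c * x ^+ (p ^ k.*2), y')].
Proof.
have [c [hA hB hP]] := supersingular_mulp.
elim: k => [|k [d [dA dB dP]]].
  by exists 1; split; rewrite ?expr1n ?mul1r // => P x y ->; exists y; rewrite mul1r.
have e2 : (p ^ k.+1.*2 = p ^ k.*2 * p ^ 2)%N by rewrite doubleS -expnD addn2.
have step n (X : K) : c ^+ n * X ^+ (p ^ 2) = X -> d ^+ n * X ^+ (p ^ k.*2) = X ->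
    (c * d ^+ (p ^ 2)) ^+ n * X ^+ (p ^ k.+1.*2) = X.
  by move=> hc hd; rewrite e2 exprM -[RHS]hc -[in RHS]hd !exprMn (exprAC d n) mulrA.
exists (c * d ^+ (p ^ 2)); split; [exact: step|exact: step|].
move=> P x y /dP[y' /hP[y'' e]]; exists y''.
by rewrite expnSr mulrnA e e2 exprMn mulrA -exprM.
Qed.

End Supersingular.

(** * Frobenius and scaling maps *)

Section ShortMaps.
Variables (K : fieldType) (C : short_curve K).
Notation A := (sA C).
Notation B := (sB C).

Definition map_xy (f g : K -> K) (P : option (K * K)) :=
  if P is Some (x, y) then Some (f x, g y) else None.

Section Morphism.
Variables (h : {rmorphism K -> K}) (hA : h A = A) (hB : h B = B).

Lemma rmorph_on P : on_short C P -> on_short C (map_xy h h P).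
Proof.
by case: P => [[x y]|] //= /eqP e; rewrite -{1}hA -hB -!(rmorphXn, rmorphM, rmorphD) /= -e.
Qed.

Definition spoint_map (P : spoint C) : spoint C := SPoint (rmorph_on (spoint_on P)).

Lemma spoint_mapD : {morph spoint_map : P Q / P + Q}.
Proof.
move=> [P c] [Q c']; apply: val_inj => /=.
case: P Q c c' => [[x1 y1]|] [[x2 y2]|] // _ _ /=.
rewrite -rmorphN !(inj_eq (fmorph_inj h)); case: ifP => // _.
have -> : slope C (h x1) (h y1) (h x2) (h y2) = h (slope C x1 y1 x2 y2).
  rewrite /slope (inj_eq (fmorph_inj h)); case: ifP => _; last by rewrite fmorph_div !rmorphB.
  have -> : 3 * h x1 ^+ 2 + A = h (3 * x1 ^+ 2 + A) by rewrite -{1}hA; ring.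
  by rewrite fmorph_div; congr (_ / _); ring.
by rewrite /sline /=; congr (Some (_, _)); ring.
Qed.
End Morphism.

Section Scale.
Variables (v : K) (v0 : v != 0) (vA : v ^+ 4 * A = A) (vB : v ^+ 6 * B = B).

Lemma scale_on P : on_short C P -> on_short C (map_xy ( *%R (v ^+ 2)) ( *%R (v ^+ 3)) P).
Proof.
case: P => [[x y]|] //= /eqP e; apply/eqP; rewrite -vB exprMn e -[X in X * (_ * x)]vA.
by ring.
Qed.

(** The conditions v^4 A = A and v^6 B = B, rather than v^4 = v^6 = 1, include the extra
    automorphisms that exist when A or B is 0. *)
Definition scale (P : spoint C) : spoint C := SPoint (scale_on (spoint_on P)).

Lemma scaleD : {morph scale : P Q / P + Q}.
Proof.
have v2 : v ^+ 2 != 0 by rewrite expf_neq0.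
have v3 : v ^+ 3 != 0 by rewrite expf_neq0.
move=> [P c] [Q c']; apply: val_inj => /=.
case: P Q c c' => [[x1 y1]|] [[x2 y2]|] // c1 c2 /=.
rewrite -mulrN !(inj_eq (mulfI _)) //; case: ifP => // /negbT nO.
have -> : slope C (v ^+ 2 * x1) (v ^+ 3 * y1) (v ^+ 2 * x2) (v ^+ 3 * y2) = v * slope C x1 y1 x2 y2.
  rewrite /slope (inj_eq (mulfI _)) //; move: nO; case: eqVneq => [ex|nx] /= nO.
    have y0 : y1 != 0.
      move: nO c1 c2; rewrite -ex => nO c1 c2.
      by case: (same_abscissa c1 c2) => ey; move: nO; rewrite ey ?eqxx // => /double_neq0[].
    have -> : 3 * (v ^+ 2 * x1) ^+ 2 + A = v ^+ 4 * (3 * x1 ^+ 2 + A).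
      by rewrite mulrDr vA; ring.
    by field; rewrite (short_two C) y0 v0.
  have d0 : x2 - x1 != 0 by rewrite subr_eq0 eq_sym.
  by field; rewrite d0 -mulrBr mulf_neq0.
by rewrite /sline /=; congr (Some (_, _)); ring.
Qed.
End Scale.
End ShortMaps.

(** * Powers of Frobenius as multiplications *)

(* A group is not the union of two proper subgroups. *)
Lemma opposite_union (V W : zmodType) (f g : V -> W) :
  {morph f : x y / x + y} -> {morph g : x y / x + y} ->
  (forall x, f x = g x \/ f x = - g x) ->
  ~ (forall x, f x = g x) -> forall x, f x = - g x.
Proof.
move=> fD gD h ne x; case: (eqVneq (f x) (- g x)) => // nx; case: ne => y.
case: (h x) nx => [ex nx|->]; last by rewrite eqxx.
case: (eqVneq (f y) (g y)) => // ny; case: (h y) ny => [->|ey ny]; first by rewrite eqxx.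
case: (h (x + y)); rewrite fD gD ex ey => e.
  by move/addrI: e => e; rewrite ey e eqxx in ny.
by move: e nx; rewrite opprD ex => /addIr {1}->; rewrite eqxx.
Qed.

Section Core.
Variables (K : closedFieldType) (C : short_curve K) (p e : nat).
Notation A := (sA C).
Notation B := (sB C).
Implicit Types (P Q : spoint C).
Hypotheses (chp : p \in [pchar K]) (p3 : (3 < p)%N).
Hypothesis ss : forall P, P *+ p = 0 -> P = 0.
Variable h : {rmorphism K -> K}.
Hypotheses (hE : forall x, h x = x ^+ (p ^ e)) (hA : h A = A) (hB : h B = B).

Let pp : prime p := pcharf_prime chp.
Notation frobq := (spoint_map hA hB).
Notation q := (p ^ e)%N.

Lemma iter_fixed n X : h X = X -> X ^+ (q ^ n) = X.
Proof.
move=> hX; elim: n => [|n IH]; first exact: expr1.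
by rewrite expnSr exprM IH -hE.
Qed.

Lemma frobqE m P x y : val P = Some (x, y) ->
  val (iter m frobq P) = Some (x ^+ (q ^ m), y ^+ (q ^ m)).
Proof.
by move=> eP; elim: m => [|m /= ->] //=; rewrite !hE -!exprM -expnSr.
Qed.

Lemma iter_frobq_mulp m N :
  (forall P x y, val P = Some (x, y) -> exists y', val (P *+ N) = Some (x ^+ (q ^ m), y')) ->
  forall P, iter m frobq P = P *+ N \/ iter m frobq P = - (P *+ N).
Proof.
move=> hx P; case eP : (val P) => [[x y]|].
  by have [y' e'] := hx _ _ _ eP; apply: same_xc (frobqE m eP) e'.
have -> : P = 0 by apply: val_inj.
left; rewrite mul0rn; elim: m {hx} => //= m ->.
by apply: val_inj.
Qed.

(** Abscissae under [q] are c x^(q^2). If c were not 1, the scaling by v with v^2 = 1/c would give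
    pi^2 = v[q] pointwise up to sign. The sign is uniform by [opposite_union], and either sign
    contradicts [frobenius_twist_contra], applied to v or to -v. *)
Lemma frobenius_odd : odd e -> exists N, forall P,
  iter 2 frobq P = P *+ N \/ iter 2 frobq P = - (P *+ N).
Proof.
move=> oe; have [c [cA cB hc]] := supersingular_mulp_iter chp p3 ss e.
have eq2 : (p ^ e.*2 = q ^ 2)%N by rewrite -expnM muln2.
rewrite eq2 !iter_fixed // in cA cB; rewrite eq2 in hc.
suff c1 : c = 1.
  by exists q; apply: iter_frobq_mulp => P x y /hc; rewrite c1 mul1r.
have AB : (A != 0) || (B != 0).
  rewrite -negb_and; apply/negP => /andP[/eqP A0 /eqP B0].
  by have := short_disc C; rewrite A0 B0 !expr0n !mulr0 addr0 eqxx.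
have c0 : c != 0.
  apply: contraTneq AB => c0; move: cA cB.
  by rewrite c0 !expr0n !mul0r => <- <-; rewrite eqxx.
apply/eqP/negPn/negP => nc.
have /closed_rootP[u] : size ('X^2 - c%:P : {poly K}) != 1 by rewrite size_XnsubC.
rewrite rootE !hornerE subr_eq0 => /eqP ec.
have u0 : u != 0 by apply: contraNneq c0 => u0; rewrite -ec u0 expr0n.
pose v := u^-1; have v0 : v != 0 by rewrite invr_eq0.
have v2 : v ^+ 2 != 1 by rewrite exprVn ec invr_eq1.
have vX n X : c ^+ n * X = X -> v ^+ (2 * n) * X = X.
  by move=> cX; rewrite -{1}cX exprM mulrA -exprMn exprVn ec mulVf ?expr1n ?mul1r.
have sE (w : K) (w0 : w != 0) (wA : w ^+ 4 * A = A) (wB : w ^+ 6 * B = B) P x y :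
    val P = Some (x, y) -> val (scale wA wB P) = Some (w ^+ 2 * x, w ^+ 3 * y).
  by move=> /= ->.
have contra (w : K) (wA : w ^+ 4 * A = A) (wB : w ^+ 6 * B = B) : w != 0 -> w ^+ 2 != 1 ->
    ~ (forall P, frobq (frobq P) = - (scale wA wB P *+ q)).
  move=> w0 w2; apply: (frobenius_twist_contra w0 w2 (sE w w0 wA wB) pp p3 oe).
    by move=> P x y /= ->; rewrite /= !hE.
  exact: spoint_mapD.
have vA : v ^+ 4 * A = A := vX 2 _ cA.
have vB : v ^+ 6 * B = B := vX 3 _ cB.
have nA : (- v) ^+ 4 * A = A by rewrite -[RHS]vA; ring.
have nB : (- v) ^+ 6 * B = B by rewrite -[RHS]vB; ring.
have sN P : scale nA nB P = - scale vA vB P.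
  apply: val_inj => /=; case: (spoint_val P) => [[x y]|] //=.
  by congr (Some (_, _)); ring.
apply: (contra v vA vB v0 v2).
have qD : {morph (fun P => scale vA vB P *+ q) : P Q / P + Q}.
  by move=> P Q; rewrite (scaleD v0) mulrnDl.
have ffD : {morph (fun P => frobq (frobq P)) : P Q / P + Q}.
  by move=> P Q; rewrite !spoint_mapD.
apply: (opposite_union ffD qD) => [P|eqall].
  have -> : scale vA vB P *+ q = scale vA vB (P *+ q).
    elim: (q) => [|n IH]; first by apply: val_inj.
    by rewrite !mulrS (scaleD v0) IH.
  case eP : (val P) => [[x y]|].
    have [y' ey'] := hc _ _ _ eP.
    apply: (same_xc (@frobqE 2 _ _ _ eP)).
    by rewrite (sE _ v0 _ _ _ _ _ ey') mulrA exprVn ec mulVf // mul1r.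
  have -> : P = 0 by apply: val_inj.
  by left; rewrite mul0rn; apply: val_inj.
have nv0 : - v != 0 by rewrite oppr_eq0.
have nv2 : (- v) ^+ 2 != 1 by rewrite sqrrN.
apply: (contra (- v) nA nB nv0 nv2) => P.
by rewrite sN mulNrn opprK.
Qed.

Lemma frobenius_even_generic : ~~ odd e -> A != 0 -> B != 0 -> exists N, forall P,
  iter 1 frobq P = P *+ N \/ iter 1 frobq P = - (P *+ N).
Proof.
move=> oe A0 B0; have [c [cA cB hc]] := supersingular_mulp_iter chp p3 ss e./2.
have eq1 : (p ^ (e./2).*2 = q ^ 1)%N by rewrite expn1 even_halfK.
rewrite eq1 !iter_fixed // in cA cB; rewrite eq1 in hc.
have c2 : c ^+ 2 = 1 by apply: (mulIf A0); rewrite cA mul1r.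
have c3 : c ^+ 3 = 1 by apply: (mulIf B0); rewrite cB mul1r.
have c1 : c = 1 by rewrite -c3 exprS c2 mulr1.
by exists (p ^ e./2)%N; apply: iter_frobq_mulp => P x y /hc; rewrite c1 mul1r.
Qed.

(** Let c be the constant of [p^(e/2)]. If B = 0 then c^2 = 1, if A = 0 then c^3 = 1, and in both
    cases c^q = c; so composing two or three copies of [p^(e/2)] gives the constant c^2 or c^3,
    which is 1. *)
Lemma frobenius_even : ~~ odd e -> exists2 m, m \in [:: 1; 2; 3]%N &
  exists N, forall P, iter m frobq P = P *+ N \/ iter m frobq P = - (P *+ N).
Proof.
move=> oe; case: (eqVneq A 0) => [A0|A0]; last first.
  case: (eqVneq B 0) => [B0|B0]; last by exists 1%N => //; apply: frobenius_even_generic.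
  exists 2%N => //; have [c [cA _ hc]] := supersingular_mulp_iter chp p3 ss e./2.
  have eq1 : (p ^ (e./2).*2 = q)%N by rewrite even_halfK.
  rewrite eq1 -hE hA in cA; rewrite eq1 in hc.
  have c2 : c ^+ 2 = 1 by apply: (mulIf A0); rewrite cA mul1r.
  have cq : c ^+ q = c.
    have oq : odd q by rewrite oddX (odd_pchar chp p3) orbT.
    by rewrite -(odd_double_half q) oq exprD -mul2n exprM c2 expr1n mulr1.
  exists (p ^ e./2 * p ^ e./2)%N; apply: iter_frobq_mulp => P x y /hc[y' /hc[y'' ey]].
  by exists y''; rewrite mulrnA ey exprMn mulrA cq -expr2 c2 mul1r -exprM.
exists 3%N => //; have [c [_ cB hc]] := supersingular_mulp_iter chp p3 ss e./2.
have B0 : B != 0.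
  by apply/eqP => B0; have := short_disc C; rewrite A0 B0 !expr0n !mulr0 addr0 eqxx.
have eq1 : (p ^ (e./2).*2 = q)%N by rewrite even_halfK.
rewrite eq1 -hE hB in cB.
have c3 : c ^+ 3 = 1 by apply: (mulIf B0); rewrite cB mul1r.
have cq : c ^+ q = c.
  (* q is the square of [p ^ e./2], which is prime to 3, so q is 1 modulo 3. *)
  have q3 : (q = q %/ 3 * 3 + 1)%N.
    rewrite {1}(divn_eq q 3) -eq1 -muln2 expnM -modnXm; congr (_ + _)%N.
    have : ~~ (3 %| p ^ e./2)%N.
      rewrite Euclid_dvdX //; apply/negP => /andP[]; rewrite dvdn_prime2 // => /eqP e3.
      by move: p3; rewrite -e3.
    move: (ltn_pmod (p ^ e./2) (isT : 0 < 3)%N); rewrite /dvdn.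
    by case: (p ^ e./2 %% 3)%N => [|[|[|]]].
  by rewrite q3 mulnC exprD exprM c3 expr1n mul1r.
rewrite eq1 in hc.
exists (p ^ e./2 * p ^ e./2 * p ^ e./2)%N; apply: iter_frobq_mulp => P x y /hc[y1 /hc[y2 /hc[y3 ey]]].
exists y3; have cM z : (c * z) ^+ q = c * z ^+ q by rewrite exprMn cq.
have ccc : c * c * c = 1 by rewrite -c3; ring.
by rewrite !mulrnA ey !cM !mulrA ccc mul1r -!exprM.
Qed.

End Core.

(** * Reduction to short Weierstrass form *)

Section Transfer.
Variables (K : fieldType) (E : ellcurve K).
Hypotheses (two0 : (2 : K) != 0) (three0 : (3 : K) != 0).

(** Completing the square in y and the cube in x; [short_A] and [short_B] are the classical -c4/48
    and -c6/864. *)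
Definition short_A : K := wb4 E / 2 - wb2 E ^+ 2 / (2 ^+ 4 * 3).
Definition short_B : K :=
  wb6 E / 2 ^+ 2 - wb2 E * wb4 E / (2 ^+ 3 * 3) + wb2 E ^+ 3 / (2 ^+ 5 * 3 ^+ 3).

Lemma smooth_neq0 a b : (2 ^ a * 3 ^ b)%:R != 0 :> K.
Proof. by rewrite natrM !natrX mulf_neq0 // expf_neq0. Qed.

Let nonzeros := (two0, three0, smooth_neq0 2 0 : (4 : K) != 0, smooth_neq0 3 1 : (24 : K) != 0,
  smooth_neq0 4 1 : (48 : K) != 0, smooth_neq0 5 3 : (864 : K) != 0,
  smooth_neq0 2 1 : (12 : K) != 0).

(** With [wdisc_short] it shows that [short_A] = 0 gives j = 0 and [short_B] = 0 gives j = 1728. *)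
Lemma wc4_short : wc4 E = - (2 ^+ 4 * 3) * short_A.
Proof. by rewrite /wc4 /short_A; field; rewrite !nonzeros. Qed.

Lemma wdisc_short : wdisc E = - (2 ^+ 4) * (4 * short_A ^+ 3 + 27 * short_B ^+ 2).
Proof.
rewrite /wdisc /short_A /short_B /wb8 /wb6 /wb4 /wb2.
by field; rewrite !nonzeros.
Qed.

Lemma short_disc_neq0 : 4 * short_A ^+ 3 + 27 * short_B ^+ 2 != 0.
Proof. by apply: contraNneq (ell_disc_neq0 E) => e; rewrite wdisc_short e mulr0. Qed.

Definition short_form : short_curve K := ShortCurve short_disc_neq0 two0.

Definition to_short (P : option (K * K)) : option (K * K) :=
  if P is Some (x, y)
  then Some (x + wb2 E / (2 ^+ 2 * 3), y + (wa1 E * x + wa3 E) / 2) else None.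

Definition of_short (P : option (K * K)) : option (K * K) :=
  if P is Some (x, y) then
    let x' := x - wb2 E / (2 ^+ 2 * 3) in Some (x', y - (wa1 E * x' + wa3 E) / 2)
  else None.

Lemma to_shortK : cancel to_short of_short.
Proof. by case=> [[x y]|] //=; congr (Some (_, _)); rewrite addrK // addrK. Qed.

Lemma of_shortK : cancel of_short to_short.
Proof. by case=> [[x y]|] //=; congr (Some (_, _)); rewrite subrK. Qed.

Lemma on_to_short P : on_short short_form (to_short P) = oncurve E P.
Proof.
case: P => [[x y]|] //=; rewrite -subr_eq0 -[RHS]subr_eq0; congr (_ == 0).
by rewrite /short_A /short_B /wb6 /wb4 /wb2; field; rewrite !nonzeros.
Qed.

(** The coordinate change is affine and preserves vertical lines, so it carries chords and tangents
    to chords and tangents. *)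
Lemma to_short_add P Q : oncurve E P -> oncurve E Q ->
  to_short (add_raw E P Q) = sadd_raw short_form (to_short P) (to_short Q).
Proof.
rewrite -!on_to_short.
case: P Q => [[x1 y1]|] [[x2 y2]|] // c1 c2.
rewrite [in RHS]/to_short [RHS]/= (inj_eq (addIr _)).
have -> : (y1 + (wa1 E * x1 + wa3 E) / 2 == - (y2 + (wa1 E * x2 + wa3 E) / 2))
  = ((y1 + y2 + (wa1 E * (x1 + x2)) / 2 + wa3 E) == 0).
  by rewrite -addr_eq0; congr (_ == 0); field.
rewrite /add_raw; case: (eqVneq x1 x2) => [ex|nx] /=; last first.
  rewrite /slope (inj_eq (addIr _)) (negbTE nx) /sline /chord /=.
  have d0 : x2 - x1 != 0 by rewrite subr_eq0 eq_sym.
  have [k ek] : exists k, k = wb2 E / (2 ^+ 2 * 3) by eexists.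
  have ea2 : wa2 E = 3 * k - wa1 E ^+ 2 / 2 ^+ 2.
    by rewrite ek /wb2; field; rewrite !nonzeros.
  have d1 : x2 + k - (x1 + k) != 0 by rewrite opprD addrACA subrr addr0.
  by rewrite -ek ea2; congr (Some (_, _)); field; rewrite ?d0 ?d1 !nonzeros.
subst x2.
have -> : y1 + y2 + wa1 E * (x1 + x1) / 2 + wa3 E = y1 + y2 + wa1 E * x1 + wa3 E by field.
case: ifPn => // n0.
have ey : y2 = y1.
  case: (same_abscissa c1 c2) => [/addIr //|ey].
  move: n0; rewrite (_ : _ + _ = 0) ?eqxx // -[RHS](addNr (y2 + (wa1 E * x1 + wa3 E) / 2)) -ey.
  by field.
subst y2; have d0 : 2 * y1 + wa1 E * x1 + wa3 E != 0.
  by rewrite (_ : 2 * y1 = y1 + y1) //; ring.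
rewrite /slope eqxx /sline /chord /=.
have d1 : y1 * 2 + (wa1 E * x1 + wa3 E) != 0 by rewrite mulrC addrA.
by congr (Some (_, _)); rewrite /short_A /wb4 /wb2; field; rewrite d1 !nonzeros.
Qed.

Definition short_point (P : point E) : spoint short_form :=
  SPoint (etrans (on_to_short _) (point_oncurve P) : on_short short_form (to_short (point_val P))).

Lemma short_point_add P Q : short_point (addp P Q) = short_point P + short_point Q.
Proof. by apply/val_inj/to_short_add; apply: point_oncurve. Qed.

Lemma short_point0 : short_point (point0 E) = 0.
Proof. exact: val_inj. Qed.

Lemma short_point_inj : injective short_point.
Proof. by move=> P Q [] /(can_inj to_shortK) e; apply: val_inj. Qed.

Lemma short_point_surj P : exists Q, short_point Q = P.
Proof.
have c : oncurve E (of_short (val P)) by rewrite -on_to_short of_shortK; case: P.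
by exists (Point c); apply: val_inj; rewrite /= of_shortK.
Qed.

Lemma short_point_mul n P : short_point (mulp n P) = short_point P *+ n.
Proof.
elim: n => [|n IH]; first exact: short_point0.
by rewrite mulrS -IH -short_point_add.
Qed.

End Transfer.

(** * Kernels of isogenies *)

Lemma pchar_exp_rmorphism (K : fieldType) p e : p \in [pchar K] ->
  exists h : {rmorphism K -> K}, forall x, h x = x ^+ (p ^ e).
Proof.
move=> chp; elim: e => [|e [h hE]]; first by exists idfun => x; rewrite expr1.
exists (pFrobenius_aut chp \o h) => x.
by rewrite /= pFrobenius_autE hE -exprM -expnSr.
Qed.

Lemma short_AB_fixed (K : fieldType) (E : ellcurve K) (h : {rmorphism K -> K}) :
  map_weierstrass h E = E ->
  [/\ h (short_A E) = short_A E, h (short_B E) = short_B E,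
      h (wa1 E) = wa1 E, h (wa3 E) = wa3 E & h (wb2 E) = wb2 E].
Proof.
move=> e; have h1 : h (wa1 E) = wa1 E by rewrite -[in RHS]e.
have h2 : h (wa2 E) = wa2 E by rewrite -[in RHS]e.
have h3 : h (wa3 E) = wa3 E by rewrite -[in RHS]e.
have h4 : h (wa4 E) = wa4 E by rewrite -[in RHS]e.
have h6 : h (wa6 E) = wa6 E by rewrite -[in RHS]e.
have b2 : h (wb2 E) = wb2 E by rewrite -[in RHS]/(wb2 _) -[in RHS]e /wb2 /=; ring.
have b4 : h (wb4 E) = wb4 E by rewrite -[in RHS]e /wb4 /=; ring.
have b6 : h (wb6 E) = wb6 E by rewrite -[in RHS]e /wb6 /=; ring.
split=> //; rewrite /short_A /short_B; move: (wb2 E) (wb4 E) (wb6 E) b2 b4 b6 => u v w b2 b4 b6;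
  rewrite ?[h (_ + _ ^+ 3 / _)]rmorphD rmorphB !(rmorph_nat, rmorphXn, fmorphV, rmorphM) /=.
  by rewrite b2 b4.
by rewrite b2 b4 b6.
Qed.

Lemma to_short_map (K : fieldType) (E : ellcurve K) (h : {rmorphism K -> K}) P :
  map_weierstrass h E = E -> to_short E (map_xy h h P) = map_xy h h (to_short E P).
Proof.
case/short_AB_fixed=> _ _; case: P => [[x y]|] //=.
move: (wa1 E) (wa3 E) (wb2 E) => a1 a3 b2 h1 h3 h2; congr (Some (_, _)).
  by rewrite rmorphD !(rmorph_nat, rmorphXn, fmorphV, rmorphM) /= h2.
by rewrite rmorphD fmorph_div rmorphD rmorph_nat rmorphM h1 h3.
Qed.

Lemma not_injective_on_nat (T : eqType) (s : seq T) (f : nat -> T) :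
  (forall i, f i \in s) -> exists i j, (i < j)%N /\ f i = f j.
Proof.
move=> fs; have /(uniqPn (f 0%N))[i [j [ij js e]]] : ~~ uniq (mkseq f (size s).+1).
  apply/negP => u; have : (size (mkseq f (size s).+1) <= size s)%N.
    by apply: uniq_leq_size u _ => x /mapP[i _ ->].
  by rewrite size_mkseq ltnn.
rewrite size_mkseq in js; exists i, j; split=> //.
by move: e; rewrite !nth_mkseq // (ltn_trans ij).
Qed.

Lemma add0p (K : fieldType) (E : ellcurve K) (P : point E) : addp (point0 E) P = P.
Proof. exact: val_inj. Qed.

Section Isogeny.
Variables (K : closedFieldType) (two0 : (2 : K) != 0) (three0 : (3 : K) != 0).

Lemma addp_eq_self (E : ellcurve K) (P : point E) : addp P P = P -> P = point0 E.
Proof.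
move=> e; apply: (@short_point_inj _ E two0 three0); rewrite short_point0.
by apply: (addIr (short_point two0 three0 P)); rewrite -short_point_add e add0r.
Qed.

Variables (E E' : ellcurve K) (psi : isogeny E E').
Notation S := (isog_ker psi).
Notation sp := (short_point (E := E) two0 three0).

Lemma isog_ker0 : S (point0 E).
Proof. by apply: addp_eq_self; rewrite -isog_add; congr (psi _); apply: val_inj. Qed.

Lemma isog_kerM n P : S P -> S (mulp n P).
Proof.
move=> SP; elim: n => [|n IH] /=; first exact: isog_ker0.
by rewrite /isog_ker isog_add SP add0p; exact: IH.
Qed.

Lemma isog_kerN P Q : sp P = - sp Q -> S Q -> S P.
Proof.
move=> e SQ; have e0 : addp P Q = point0 E.
  apply: (@short_point_inj _ _ two0 three0).
  by rewrite short_point_add e addNr short_point0.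
have := isog_add psi P Q; rewrite e0 SQ (isog_ker0 : psi _ = _) /isog_ker => ->.
by apply: val_inj; case: (psi P) => [[[x y]|] c].
Qed.

(** A sign depending on the point is harmless, because a kernel is closed under negation. *)
Lemma isog_ker_combination P Q N :
  sp Q = sp P *+ N \/ sp Q = - (sp P *+ N) -> S P -> S Q.
Proof.
rewrite -short_point_mul => -[/short_point_inj -> |e] SP; first exact: isog_kerM.
exact: isog_kerN e (isog_kerM N SP).
Qed.
End Isogeny.

(** * Frobenius-stable sets and the field of definition of a kernel *)

Section Frobenius.
Variables (F : finFieldType) (K : closedFieldType) (iota : {rmorphism F -> K}).
Variables (algK : forall x : K, algebraicOver iota x) (E : ellcurve F).
Variable h : {rmorphism K -> K}.
Hypothesis hE : forall x, h x = x ^+ #|F|.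
Notation frob := (frob (iota := iota) (E := E)).

Lemma fixed_iota a : h (iota a) = iota a.
Proof. by rewrite hE -rmorphXn /= expf_card. Qed.

(** The conjugates of x are roots of one polynomial over the finite field. *)
Lemma orbit_finite x : exists s : seq K, forall i, iter i h x \in s.
Proof.
have [g g0 gx] := algK x; have g1 : map_poly iota g != 0 by rewrite map_poly_eq0.
have [r er] := closed_field_poly_normal (map_poly iota g); exists r => i.
rewrite -root_prod_XsubC -(rootZ _ _ (_ : lead_coef (map_poly iota g) != 0)) ?lead_coef_eq0 //.
rewrite -er; elim: i => //= i; move: (iter i h x) => y /eqP ry.
have -> : map_poly iota g = map_poly h (map_poly iota g).
  by rewrite -map_poly_comp; apply: eq_map_poly => a /=; rewrite fixed_iota.
by rewrite rootE horner_map ry rmorph0.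
Qed.

Lemma frobE (P : point (base_change iota E)) : val (frob P) = map_xy h h (val P).
Proof. by case: P => [[[x y]|] c] //=; rewrite !hE. Qed.

Lemma frob_inj : injective frob.
Proof.
move=> P Q /(congr1 val); rewrite !frobE => e; apply: val_inj; move: e.
by case: (val P) (val Q) => [[x y]|] [[x' y']|] //= [/fmorph_inj -> /fmorph_inj ->].
Qed.

(** A finite orbit repeats a value, and injectivity of Frobenius moves the repetition back to P
    itself. *)
Lemma frob_periodic P : exists2 k, (0 < k)%N & iter k frob P = P.
Proof.
have [s hs] : exists s : seq (option (K * K)), forall i, val (iter i frob P) \in s.
  case eP : (val P) => [[x y]|].
    have [r hr] := orbit_finite x; have [t ht] := orbit_finite y.
    exists [seq Some (a, b) | a <- r, b <- t] => i.
    have -> : val (iter i frob P) = Some (iter i h x, iter i h y).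
      by elim: i => [|i IH] //; rewrite iterS frobE IH.
    exact: allpairs_f.
  exists [:: None] => i; have -> : val (iter i frob P) = None; last by rewrite inE.
  by elim: i => [|i IH] //; rewrite iterS frobE IH.
have [i [j [ij /val_inj e]]] := not_injective_on_nat hs.
exists (j - i)%N; first by rewrite subn_gt0.
have inj n : injective (iter n frob) by elim: n => // n IH x y /= /frob_inj/IH.
by apply: (inj i); rewrite -iterD subnKC ?(ltnW ij).
Qed.

(** Inclusion suffices: if Q has period k + 1 under pi, then Q is the image under pi^m of the k-th
    iterate of pi^m at Q, which lies in S. *)
Lemma defined_over_extP m (S : point (base_change iota E) -> Prop) :
  (forall P, S P -> S (iter m frob P)) -> defined_over_ext m S.
Proof.
move=> hS Q; split=> [[P SP <-]|SQ]; first exact: hS.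
have [[|k] // _ ek] := frob_periodic Q.
exists (iter k (iter m frob) Q); first by elim: k {ek} => //= k; exact: hS.
have itM n : iter n (iter m frob) Q = iter (n * m) frob Q.
  by elim: n => // n IH; rewrite iterS IH mulSn iterD.
rewrite -iterS itM mulnC; elim: m {hS itM} => // m IH.
by rewrite mulSn iterD IH.
Qed.
End Frobenius.

Theorem lemma2p2 (p e : nat) (p_prime : prime p) (p_gt3 : (3 < p)%N)
    (e_gt0 : (0 < e)%N) (F : finFieldType) (cardF : #|F| = (p ^ e)%N)
    (K : closedFieldType) (iota : {rmorphism F -> K})
    (algK : forall x : K, algebraicOver iota x)
    (E : ellcurve F) (ssE : supersingular (base_change iota E))
    (E' : ellcurve K) (psi : isogeny (base_change iota E) E') :
  (exists2 m, m \in [:: 1; 2; 3]%N & defined_over_ext m (isog_ker psi)) /\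
  (jinv E != 0 -> jinv E != 1728 ->
    (~~ odd e -> defined_over_ext 1 (isog_ker psi)) /\
    (odd e -> defined_over_ext 2 (isog_ker psi))).
Proof.
have chK : p \in [pchar K].
  rewrite (fmorph_pchar iota); have [p0 p0_prime chF] := finPcharP F.
  have := cardF; rewrite (card_pprimeChar chF) => ec.
  suff -> : p = p0 by [].
  apply/eqP; rewrite -dvdn_prime2 //; have : (p %| p ^ e)%N by rewrite dvdn_exp.
  by rewrite -ec Euclid_dvdX // => /andP[].
have nat0 n : (0 < n < p)%N -> n%:R != 0 :> K.
  by move=> /andP[n0 np]; rewrite -(dvdn_pcharf chK) gtnNdvd.
have two0 : (2 : K) != 0 by apply: nat0; exact: ltnW.
have three0 : (3 : K) != 0 by apply: nat0.
have [h hE'] := pchar_exp_rmorphism e chK.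
have hE x : h x = x ^+ #|F| by rewrite cardF.
set E0 := base_change iota E in ssE psi *; pose C := short_form E0 two0 three0.
have eW : map_weierstrass h E0 = E0.
  by rewrite /map_weierstrass /= !(fixed_iota iota hE).
have [hA hB _ _ _] := short_AB_fixed eW.
pose sp := short_point (E := E0) two0 three0.
have ss (P : spoint C) : P *+ p = 0 -> P = 0.
  (* The prime provided by [supersingular] is the characteristic, hence p. *)
  case: ssE => p' chp' ssE; have ep : p' = p by move: chp'; rewrite (pcharf_eq chK) => /eqP.
  have [Q <-] := short_point_surj P.
  rewrite -short_point_mul -(short_point0 E0 two0 three0) => /short_point_inj.
  by rewrite -ep => /ssE ->.
pose frobC := @spoint_map K C h hA hB.
have spF P : sp (frob P) = frobC (sp P).
  apply: val_inj; transitivity (to_short E0 (val (frob P))) => //; rewrite (frobE hE).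
  exact: to_short_map.
have spFn m P : sp (iter m (@frob F K iota E) P) = iter m frobC (sp P).
  by elim: m => //= m <-; rewrite spF.
(* It remains to find a power of Frobenius on the short model that is, pointwise up to sign, a
   multiplication by an integer. *)
have main m : (exists N, forall P, iter m frobC P = P *+ N \/ iter m frobC P = - (P *+ N)) ->
    defined_over_ext m (isog_ker psi).
  move=> [N hN]; apply: (defined_over_extP algK hE) => P.
  by apply: (@isog_ker_combination K two0 three0 _ _ _ _ _ N); rewrite -/sp spFn; apply: hN.
split.
  have [oe|oe] := boolP (odd e).
    by exists 2%N => //; apply: main; apply: (frobenius_odd chK p_gt3 ss hE').
  have [m mi hm] := frobenius_even chK p_gt3 ss hE' hA hB oe.
  by exists m => //; apply: main.
have c4E : iota (wc4 E) = wc4 E0 by rewrite /wc4 /wb2 /wb4 /=; ring.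
move=> j0 j1728; split=> oe; last by apply: main; apply: (frobenius_odd chK p_gt3 ss hE').
apply: main; apply: (frobenius_even_generic chK p_gt3 ss hE') => //.
- apply: contraNneq j0 => /= A0; rewrite /jinv.
  suff -> : wc4 E = 0 by rewrite expr0n mul0r.
  by apply: (fmorph_inj iota); rewrite c4E (wc4_short E0 two0 three0) A0 mulr0 rmorph0.
(* If [short_B] = 0 then c4^3 = -48^3 A^3 is 1728 times the discriminant -64 A^3. *)
apply: contraNneq j1728 => /= B0; apply/eqP.
rewrite /jinv; apply: (mulIf (ell_disc_neq0 E)); rewrite divfK ?ell_disc_neq0 //.
apply: (fmorph_inj iota); rewrite rmorphXn rmorphM /= -(wdisc_map iota E) rmorph_nat c4E.
rewrite (wc4_short E0 two0 three0) -[wdisc _]/(wdisc E0) (wdisc_short E0 two0 three0) B0; ring.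
Qed.
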